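(* Let $\mathbf K(\boldsymbol\mu)\in\mathbb C^{N\times m_0}$ and $\mathbf B(\boldsymbol\mu)\in\mathbb C^{m_0\times m_0}$ be the analytic matrix functions near $\boldsymbol\mu_0$ defined in the context, with Taylor coefficients $\mathbf K^{(\boldsymbol\beta)}$, $\mathbf B^{(\boldsymbol\beta)}$ at $\boldsymbol\mu_0$. For $\boldsymbol\beta\in\mathbb N_0^d$ set $$\mathbf X^{(\boldsymbol\beta)}:=\sum_{\substack{\boldsymbol\nu_1+\boldsymbol\nu_2=\boldsymbol\beta\\ \boldsymbol\nu_1\notin\{\mathbf 0,\boldsymbol\beta\}}}\mathbf A^{(\boldsymbol\nu_1)}\mathbf K^{(\boldsymbol\nu_2)},\qquad \mathbf Y^{(\boldsymbol\beta)}:=\sum_{\substack{\boldsymbol\nu_1+\boldsymbol\nu_2=\boldsymbol\beta\\ \boldsymbol\nu_1\notin\{\mathbf 0,\boldsymbol\beta\}}}\mathbf K^{(\boldsymbol\nu_1)}\mathbf B^{(\boldsymbol\nu_2)}$$ (with $\boldsymbol\nu_1,\boldsymbol\nu_2\in\mathbb N_0^d$ and empty sums equal to $\mathbf 0$). Then for every $\boldsymbol\beta\in\mathbb N_0^d$, $$\mathbf K^{(\boldsymbol\beta)}=\mathbf S_0\big(-\mathbf A^{(\boldsymbol\beta)}\mathbf U_0-\mathbf X^{(\boldsymbol\beta)}+\mathbf Y^{(\boldsymbol\beta)}\big),$$ where $\mathbf B^{(\mathbf 0)}=\lambda_0\mathbf I_{m_0}$ and $$\mathbf B^{(\boldsymbol\beta)}=\mathbf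 U_0^*\mathbf A^{(\boldsymbol\beta)}\mathbf U_0+\mathbf U_0^*\mathbf X^{(\boldsymbol\beta)}\in\mathbb C^{m_0\times m_0}\qquad\text{for }|\boldsymbol\beta|\ge1 .$$
   Context: $\mathcal P\subseteq\mathbb R^d$ is open, $\boldsymbol\mu_0\in\mathcal P$, and $\mathbf A:\mathcal P\to\mathbb C^{N\times N}$ is Hermitian-matrix-valued and real-analytic, with convergent expansion $\mathbf A(\boldsymbol\mu)=\sum_{\boldsymbol\beta\in\mathbb N_0^d}(\boldsymbol\mu-\boldsymbol\mu_0)^{\boldsymbol\beta}\mathbf A^{(\boldsymbol\beta)}$ near $\boldsymbol\mu_0$; $|\boldsymbol\beta|=\beta_1+\dots+\beta_d$. $\lambda_0$ is an eigenvalue of $\mathbf A_0:=\mathbf A(\boldsymbol\mu_0)$ with multiplicity $m_0$ and orthogonal eigenprojector $\mathbf P_0$; $\mathbf P_0^\perp:=\mathbf I-\mathbf P_0$. The reduced resolvent $\mathbf S_0$ of $\mathbf A_0$ at $\lambda_0$ is characterized by $\mathbf S_0\mathbf P_0=\mathbf P_0\mathbf S_0=\mathbf 0$ and $(\mathbf A_0-\lambda_0\mathbf I)\mathbf S_0=\mathbf S_0(\mathbf A_0-\lambda_0\mathbf I)=\mathbf I-\mathbf P_0$. For $\boldsymbol\mu$ near $\boldsymbol\mu_0$, $\mathbf P_0(\boldsymbol\mu):=\frac{-1}{2\pi i}\oint_\Gamma(\mathbf A(\boldsymbol\mu)-\zeta\mathbf I)^{-1}d\zeta$, where $\Gamma$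 is a closed contour encircling only the eigenvalue $\lambda_0$ of $\mathbf A_0$; it is an analytic orthogonal-projector-valued function commuting with $\mathbf A(\boldsymbol\mu)$ with $\mathbf P_0(\boldsymbol\mu_0)=\mathbf P_0$. The matrix $\mathbf U_0\in\mathbb C^{N\times m_0}$ satisfies $\mathbf U_0^*\mathbf U_0=\mathbf I_{m_0}$, $\mathbf U_0\mathbf U_0^*=\mathbf P_0$. Set $$\mathbf U(\boldsymbol\mu):=\mathbf P_0(\boldsymbol\mu)\mathbf U_0,\quad \mathbf C(\boldsymbol\mu):=\mathbf U_0^*\mathbf P_0(\boldsymbol\mu)\mathbf U_0,$$ $$\mathbf K(\boldsymbol\mu):=\mathbf P_0^\perp\mathbf U(\boldsymbol\mu)\mathbf C(\boldsymbol\mu)^{-1},\quad \mathbf B(\boldsymbol\mu):=\mathbf U_0^*\mathbf A(\boldsymbol\mu)\mathbf U(\boldsymbol\mu)\mathbf C(\boldsymbol\mu)^{-1},$$ where $\mathbf C(\boldsymbol\mu)$ is invertible for $\boldsymbol\mu$ near $\boldsymbol\mu_0$, and $\mathbf K(\boldsymbol\mu)=\sum_{\boldsymbol\beta}(\boldsymbol\mu-\boldsymbol\mu_0)^{\boldsymbol\beta}\mathbf K^{(\boldsymbol\beta)}$, $\mathbf B(\boldsymbol\mu)=\sum_{\boldsymbol\beta}(\boldsymbol\mu-\boldsymbol\mu_0)^{\boldsymbol\beta}\mathbf B^{(\boldsymbol\beta)}$. *)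

(* Defs.v *)
From HB Require Import structures.
From mathcomp Require Import all_boot all_order all_algebra.
From mathcomp Require Import finmap.
From mathcomp Require Import sesquilinear spectral.
From mathcomp Require Import all_classical all_reals all_analysis.
From mathcomp Require Import summability.
From mathcomp Require Import complex.

Set Implicit Arguments.
Unset Strict Implicit.
Unset Printing Implicit Defensive.

Import Order.TTheory GRing.Theory Num.Theory.
Import numFieldNormedType.Exports.

Local Open Scope classical_set_scope.
Local Open Scope sesquilinear_scope.
Local Open Scope complex_scope.
Local Open Scope ring_scope.

Definition multiindex (d : nat) := {ffun 'I_d -> nat}.

Definition mdegree (d : nat) (b : multiindex d) : nat := (\sum_(i < d) b i)%N.

Definition monomial (R : realType) (d : nat) (x : 'rV[R]_d) (b : multiindex d) : R :=
  \prod_(i < d) x 0 i ^+ b i.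

(* Unconditional convergence: the net of the partial sums over the finite
   subsets of [I] converges to [s].  The scalar field is kept generic because a
   topology is inferred on an abstract [numFieldType], not on [R[i]] by name. *)
Definition has_sum (I : choiceType) (K : numFieldType) (p q : nat)
    (f : I -> 'M[K]_(p, q)) (s : 'M[K]_(p, q)) : Prop :=
  partial_sum f @ totally --> s.

Definition has_expansion (R : realType) (d p q : nat)
    (F : 'rV[R]_d -> 'M[R[i]]_(p, q)) (mu0 : 'rV[R]_d)
    (c : multiindex d -> 'M[R[i]]_(p, q)) : Prop :=
  \forall mu \near mu0,
    has_sum (fun b : multiindex d => (monomial (mu - mu0) b)%:C *: c b) (F mu).

Definition real_analytic (R : realType) (d p q : nat) (P : set 'rV[R]_d)
    (F : 'rV[R]_d -> 'M[R[i]]_(p, q)) : Prop :=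
  forall mu, P mu -> exists c : multiindex d -> 'M[R[i]]_(p, q), has_expansion F mu c.

(* C^1 arcs, all parametrised by [0, 1]; [arc_vel] is the derivative, which
   extends continuously to the end points. *)
Record C1_arc (R : realType) := C1Arc {
  arc_pt : R -> R[i];
  arc_vel : R -> R[i];
  arc_pt_cts : {within `[0, 1], continuous (fun t => complex.Re (arc_pt t))} /\
               {within `[0, 1], continuous (fun t => complex.Im (arc_pt t))};
  arc_vel_cts : {within `[0, 1], continuous (fun t => complex.Re (arc_vel t))} /\
                {within `[0, 1], continuous (fun t => complex.Im (arc_vel t))};
  arc_velP : forall t : R, 0 < t < 1 ->
    is_derive t 1 (fun s => complex.Re (arc_pt s)) (complex.Re (arc_vel t)) /\
    is_derive t 1 (fun s => complex.Im (arc_pt s)) (complex.Im (arc_vel t))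
}.

(* A closed piecewise C^1 contour is a cyclic chain of C^1 arcs; [ordS] is the
   cyclic successor, so the last arc ends where the first one starts. *)
Record closed_contour (R : realType) := ClosedContour {
  narcs : nat;
  arc : 'I_narcs -> C1_arc R;
  arc_chain : forall k, arc_pt (arc k) 1 = arc_pt (arc (ordS k)) 0
}.

Definition on_contour (R : realType) (G : closed_contour R) (z : R[i]) : Prop :=
  exists (k : 'I_(narcs G)) (t : R), 0 <= t <= 1 /\ arc_pt (arc k) t = z.

Definition integral01 (R : realType) (f : R -> R[i]) : R[i] :=
  (\int[lebesgue_measure]_(t in `[0, 1]) complex.Re (f t)) +i*
  (\int[lebesgue_measure]_(t in `[0, 1]) complex.Im (f t)).

Definition contour_integral (R : realType) (G : closed_contour R)
    (f : R[i] -> R[i]) : R[i] :=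
  \sum_(k < narcs G)
    integral01 (fun t => f (arc_pt (arc k) t) * arc_vel (arc k) t).

Definition two_pi_i (R : realType) : R[i] := 0 +i* (2 * pi).

Definition winding_number (R : realType) (G : closed_contour R) (z : R[i]) : R[i] :=
  (two_pi_i R)^-1 * contour_integral G (fun zeta => (zeta - z)^-1).

(* G avoids the spectrum of M and winds once (counterclockwise) around the
   eigenvalue l and zero times around every other eigenvalue. *)
Definition encircles_only (R : realType) (N : nat) (G : closed_contour R)
    (M : 'M[R[i]]_N) (l : R[i]) : Prop :=
  forall x, eigenvalue M x ->
    ~ on_contour G x /\ winding_number G x = (if x == l then 1 else 0).

Definition riesz_projector (R : realType) (N : nat) (G : closed_contour R)
    (M : 'M[R[i]]_N) : 'M[R[i]]_N :=
  (- 1 / two_pi_i R) *: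
    \matrix_(i, j) contour_integral G (fun zeta => invmx (M - zeta%:M) i j).

(* P acts on column vectors, whereas [eigenspace] is made of row vectors. *)
Definition orthogonal_eigenprojector (R : realType) (N : nat)
    (M : 'M[R[i]]_N) (l : R[i]) (P : 'M[R[i]]_N) : Prop :=
  [/\ P \is hermsymmx, P *m P = P &
      forall v : 'cV[R[i]]_N, (exists w : 'cV[R[i]]_N, v = P *m w) <-> M *m v = l *: v].

Definition reduced_resolvent (R : realType) (N : nat)
    (M : 'M[R[i]]_N) (l : R[i]) (P S : 'M[R[i]]_N) : Prop :=
  [/\ S *m P = 0, P *m S = 0,
      (M - l%:M) *m S = 1%:M - P & S *m (M - l%:M) = 1%:M - P].

Definition Umx (R : realType) (d N m0 : nat) (G : closed_contour R)
    (A : 'rV[R]_d -> 'M[R[i]]_N) (U0 : 'M[R[i]]_(N, m0))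
    (mu : 'rV[R]_d) : 'M[R[i]]_(N, m0) :=
  riesz_projector G (A mu) *m U0.

Definition Cmx (R : realType) (d N m0 : nat) (G : closed_contour R)
    (A : 'rV[R]_d -> 'M[R[i]]_N) (U0 : 'M[R[i]]_(N, m0))
    (mu : 'rV[R]_d) : 'M[R[i]]_m0 :=
  U0 ^t* *m riesz_projector G (A mu) *m U0.

Definition Kmx (R : realType) (d N m0 : nat) (G : closed_contour R)
    (A : 'rV[R]_d -> 'M[R[i]]_N) (P0 : 'M[R[i]]_N) (U0 : 'M[R[i]]_(N, m0))
    (mu : 'rV[R]_d) : 'M[R[i]]_(N, m0) :=
  (1%:M - P0) *m Umx G A U0 mu *m invmx (Cmx G A U0 mu).

Definition Bmx (R : realType) (d N m0 : nat) (G : closed_contour R)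
    (A : 'rV[R]_d -> 'M[R[i]]_N) (U0 : 'M[R[i]]_(N, m0))
    (mu : 'rV[R]_d) : 'M[R[i]]_m0 :=
  U0 ^t* *m A mu *m Umx G A U0 mu *m invmx (Cmx G A U0 mu).

(* \sum_(nu1 + nu2 = b, nu1 \notin {0, b}) F_nu1 G_nu2.  The index set is finite,
   so the finitely supported sum is the ordinary one. *)
Definition inner_convolution (R : realType) (d p q r : nat)
    (F : multiindex d -> 'M[R[i]]_(p, q)) (G : multiindex d -> 'M[R[i]]_(q, r))
    (b : multiindex d) : 'M[R[i]]_(p, r) :=
  \sum_(nu \in [set nu : multiindex d * multiindex d |
                  [/\ nu.1 + nu.2 = b, nu.1 <> 0 & nu.1 <> b]])
    (F nu.1 *m G nu.2).

(* Main.v *)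
Require Import Defs.
From mathcomp Require Import all_boot all_order all_algebra.
From mathcomp Require Import finmap.
From mathcomp Require Import sesquilinear spectral.
From mathcomp Require Import all_classical all_reals all_analysis.
From mathcomp Require Import summability.
From mathcomp Require Import complex.
From mathcomp Require Import ring lra.

Set Implicit Arguments.
Unset Strict Implicit.
Unset Printing Implicit Defensive.

Import Order.TTheory GRing.Theory Num.Theory.
Import numFieldNormedType.Exports.

Local Open Scope classical_set_scope.
Local Open Scope sesquilinear_scope.
Local Open Scope complex_scope.
Local Open Scope ring_scope.

(** The identities are what remains when the coefficients of two analytic
    relations are compared.  Write [Q(mu)] for the Riesz projector of [A(mu)]
    and [C(mu) = U0^* Q(mu) U0].  Then [U0 + K(mu) = Q(mu) U0 C(mu)^-1], that is,
    [U0 + K(mu)] is the basis of the range of [Q(mu)] normalised by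
    [U0^* (U0 + K(mu)) = 1].  As [Q(mu)] commutes with [A(mu)], this range is
    invariant, so that near [mu0]

      U0^* K = 0,    A (U0 + K) = (U0 + K) B,    B = U0^* A (U0 + K)

    (lemma [invariant_graph]).  The coefficients of these relations at [b], the
    values [A_0 = A(mu0)], [K_0 = 0], [B_0 = lambda0], and one multiplication by
    [S0], which inverts [A_0 - lambda0] off the eigenspace, give the statement.

    Two facts have to be established before this computation can be made.

    The first is that [Q(mu)] is, for [mu] near [mu0], an idempotent commuting
    with [A(mu)] and close enough to [P0].  Diagonalising the Hermitian matrix
    [A(mu)] and integrating entrywise shows that [Q(mu)] replaces each eigenvalue
    of [A(mu)] by the winding number of the contour around it
    ([riesz_projector_diag]).  The winding number is locally constant off the
    contour, because [Log ((zeta - z') / (zeta - z))] is a single-valued primitive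
    along the contour when [z'] is close to [z]
    ([winding_number_locally_constant]); and the eigenvalues of [A(mu)] are close
    to those of [A(mu0)] ([eigenvalue_perturbation]).  Hence the weights are 1 on
    the cluster near [lambda0] and 0 elsewhere.  In place of norm continuity of
    [Q], two injectivity statements are proved ([riesz_projector_perturbation]):
    no nonzero vector lies in the range of [Q(mu)] and the kernel of [P0], and
    none lies in the range of [P0] and the kernel of [Q(mu)].  They say that
    [C(mu)] is invertible and that its size is the rank of [Q(mu)].

    The second is the comparison of coefficients.  An unconditionally convergent
    expansion has bounded terms, so its tail of degree greater than [n] is
    [O(|h|^(n+1))] ([expansion_remainder]).  Restricting to the curve
    [h_i = t^(L + (n+1)^i)] with [L] large turns the part of degree at most [n]
    into a polynomial in [t] in which distinct multi-indices have distinct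
    exponents, all smaller than [L (n+1)], while the tail is [O(t^(L (n+1)))].
    Approximation of a function of [t] by a polynomial up to [O(t^D)] is
    compatible with sums and products and determines the coefficients of index
    less than [D] ([approxM], [approx0_coef]), so products of series need not be
    rearranged. *)

(** * Real and imaginary parts *)

Section ComplexParts.
Variable R : realType.
Implicit Types (x y : R[i]).

Lemma ReD x y : complex.Re (x + y) = complex.Re x + complex.Re y.
Proof. by case: x y => [a b] [c e]. Qed.

Lemma ImD x y : complex.Im (x + y) = complex.Im x + complex.Im y.
Proof. by case: x y => [a b] [c e]. Qed.

Lemma ReB x y : complex.Re (x - y) = complex.Re x - complex.Re y.
Proof. by case: x y => [a b] [c e]. Qed.

Lemma ImB x y : complex.Im (x - y) = complex.Im x - complex.Im y.
Proof. by case: x y => [a b] [c e]. Qed.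

Lemma ReM x y :
  complex.Re (x * y) = complex.Re x * complex.Re y - complex.Im x * complex.Im y.
Proof. by case: x y => [a b] [c e]. Qed.

Lemma ImM x y :
  complex.Im (x * y) = complex.Re x * complex.Im y + complex.Im x * complex.Re y.
Proof. by case: x y => [a b] [c e]. Qed.

Lemma ReV x : complex.Re x^-1 =
  complex.Re x / (complex.Re x ^+ 2 + complex.Im x ^+ 2).
Proof. by case: x. Qed.

Lemma ImV x : complex.Im x^-1 =
  - complex.Im x / (complex.Re x ^+ 2 + complex.Im x ^+ 2).
Proof. by case: x => a b /=; rewrite mulNr. Qed.

Lemma sqr_parts_gt0 x : x != 0 -> 0 < complex.Re x ^+ 2 + complex.Im x ^+ 2.
Proof.
case: x => a b; rewrite eq_complex /= negb_and => /orP[] h.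
  by rewrite ltr_pwDl ?sqr_ge0 // exprn_even_gt0 //= h.
by rewrite ltr_wpDl ?sqr_ge0 // exprn_even_gt0 //= h.
Qed.

Lemma complex_parts_eq x y :
  complex.Re x = complex.Re y -> complex.Im x = complex.Im y -> x = y.
Proof. by case: x y => [a b] [c e] /= -> ->. Qed.

End ComplexParts.

(** * Integration of complex functions over the unit interval *)

Section ArcIntegrals.
Variable R : realType.
Implicit Types (f F : R -> R) (h k : R -> R[i]).

Definition cts01 h : Prop :=
  {within `[0, 1], continuous (fun t => complex.Re (h t))} /\
  {within `[0, 1], continuous (fun t => complex.Im (h t))}.

Let ctsP f : {within `[0, 1], continuous f} <->
  forall x : R, x \in `[0, 1]%R -> f @ within `[0, 1] (nbhs x) --> f x.
Proof. by split=> [/subspace_continuousP h x|h]; [exact: h|apply/subspace_continuousP]. Qed.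

Lemma within01D f F : {within `[0, 1], continuous f} -> {within `[0, 1], continuous F} ->
  {within `[0, 1], continuous (fun t => f t + F t)}.
Proof. by move=> /ctsP cf /ctsP cF; apply/ctsP => x x01; apply: cvgD; auto. Qed.

Lemma within01N f : {within `[0, 1], continuous f} ->
  {within `[0, 1], continuous (fun t => - f t)}.
Proof. by move=> /ctsP cf; apply/ctsP => x x01; apply: cvgN; auto. Qed.

Lemma within01M f F : {within `[0, 1], continuous f} -> {within `[0, 1], continuous F} ->
  {within `[0, 1], continuous (fun t => f t * F t)}.
Proof. by move=> /ctsP cf /ctsP cF; apply/ctsP => x x01; apply: cvgM; auto. Qed.

Lemma within01V f : {within `[0, 1], continuous f} ->
  (forall t, t \in `[0, 1]%R -> f t != 0) ->
  {within `[0, 1], continuous (fun t => (f t)^-1)}.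
Proof. by move=> /ctsP cf f0; apply/ctsP => x x01; apply: cvgV; auto. Qed.

Lemma within01_comp f F : {within `[0, 1], continuous f} ->
  (forall t, t \in `[0, 1]%R -> {for f t, continuous F}) ->
  {within `[0, 1], continuous (fun t => F (f t))}.
Proof.
move=> /ctsP cf cF; apply/ctsP => x x01.
by apply: continuous_cvg; [exact: cF|exact: cf].
Qed.

Lemma within01_cst (c : R) : {within `[0, 1], continuous (fun _ : R => c)}.
Proof. by apply/ctsP => x x01; exact: cvg_cst. Qed.

Lemma within01_integrable f : {within `[0, 1], continuous f} ->
  lebesgue_measure.-integrable `[0, 1] (EFin \o f).
Proof. by apply: continuous_compact_integrable; exact: segment_compact. Qed.

Lemma within01_FTC f F : {within `[0, 1], continuous f} ->
  {within `[0, 1], continuous F} ->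
  (forall t : R, 0 < t < 1 -> is_derive t 1 F (f t)) ->
  \int[lebesgue_measure]_(t in `[0, 1]) f t = F 1 - F 0.
Proof.
move=> cf cF dF; rewrite /Rintegral (@continuous_FTC2 _ f F 0 1) ?ltr01 //.
  split.
  - by move=> t; rewrite in_itv /= => /dF [].
  - by case/(continuous_within_itvP F (@ltr01 R)) : cF.
  - by case/(continuous_within_itvP F (@ltr01 R)) : cF.
by move=> t; rewrite in_itv /= => /dF [_ <-]; rewrite derive1E.
Qed.

Lemma cts01_cst (c : R[i]) : cts01 (fun=> c).
Proof. by split; exact: within01_cst. Qed.

Let within_eq f F : f =1 F -> {within `[0, 1], continuous f} ->
  {within `[0, 1], continuous F}.
Proof. by move=> /funext ->. Qed.

Lemma cts01D h k : cts01 h -> cts01 k -> cts01 (fun t => h t + k t).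
Proof.
move=> [h1 h2] [k1 k2]; split.
  by apply: within_eq _ (within01D h1 k1) => t; rewrite ReD.
by apply: within_eq _ (within01D h2 k2) => t; rewrite ImD.
Qed.

Lemma cts01M h k : cts01 h -> cts01 k -> cts01 (fun t => h t * k t).
Proof.
move=> [h1 h2] [k1 k2]; split.
  by apply: within_eq _ (within01D (within01M h1 k1) (within01N (within01M h2 k2))) => t;
    rewrite ReM.
by apply: within_eq _ (within01D (within01M h1 k2) (within01M h2 k1)) => t;
  rewrite ImM.
Qed.

Lemma cts01V h : cts01 h -> (forall t, t \in `[0, 1]%R -> h t != 0) ->
  cts01 (fun t => (h t)^-1).
Proof.
move=> [h1 h2] h0.
have cn : {within `[0, 1], continuous
    (fun t => (complex.Re (h t) ^+ 2 + complex.Im (h t) ^+ 2)^-1)}.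
  apply: within01V; last by move=> t /h0 /sqr_parts_gt0 /lt0r_neq0.
  by apply: within01D; apply: within01M.
split.
  by apply: within_eq _ (within01M h1 cn) => t; rewrite ReV.
by apply: within_eq _ (within01M (within01N h2) cn) => t; rewrite ImV.
Qed.

Let congr_integral01 f F g G : f =1 F -> g =1 G ->
  (\int[lebesgue_measure]_(t in `[0, 1]) f t) +i*
  (\int[lebesgue_measure]_(t in `[0, 1]) g t) =
  (\int[lebesgue_measure]_(t in `[0, 1]) F t) +i*
  (\int[lebesgue_measure]_(t in `[0, 1]) G t) :> R[i].
Proof. by move=> /funext -> /funext ->. Qed.

Lemma integral01D h k : cts01 h -> cts01 k ->
  integral01 (fun t => h t + k t) = integral01 h + integral01 k.
Proof.
move=> [h1 h2] [k1 k2].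
rewrite /integral01 (congr_integral01 (fun t => ReD (h t) (k t)) (fun t => ImD (h t) (k t))).
by rewrite !RintegralD //; exact: within01_integrable.
Qed.

Lemma integral01Z (c : R[i]) h : cts01 h ->
  integral01 (fun t => c * h t) = c * integral01 h.
Proof.
move=> [h1 h2].
have cZ (a : R) f : {within `[0, 1], continuous f} ->
    lebesgue_measure.-integrable `[0, 1] (EFin \o (fun t => a * f t)).
  by move=> cf; apply: within01_integrable; apply: within01M => //; exact: within01_cst.
rewrite /integral01 (congr_integral01 (fun t => ReM c (h t)) (fun t => ImM c (h t))).
rewrite RintegralB ?RintegralD ?RintegralZl //;
  try by [exact: cZ | exact: within01_integrable].
by apply: complex_parts_eq; rewrite ?ReM ?ImM.
Qed.

Lemma eq_integral01 h k : (forall t, t \in `[0, 1]%R -> h t = k t) ->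
  integral01 h = integral01 k.
Proof.
by move=> hk; congr (_ +i* _); apply: eq_Rintegral => t; rewrite inE /= => t01; rewrite hk.
Qed.

End ArcIntegrals.

(** * Derivatives of real functions in pointwise form *)

Section DerivativeRules.
Variable R : realType.
Implicit Types (f g : R -> R) (t a b : R).

Lemma is_derive_addfun f g t a b : is_derive t 1 f a -> is_derive t 1 g b ->
  is_derive t 1 (fun s => f s + g s) (a + b).
Proof. by move=> fa gb; exact: is_deriveD. Qed.

Lemma is_derive_subfun f g t a b : is_derive t 1 f a -> is_derive t 1 g b ->
  is_derive t 1 (fun s => f s - g s) (a - b).
Proof. by move=> fa gb; exact: is_deriveB. Qed.

Lemma is_derive_shift f t a (c : R) : is_derive t 1 f a ->
  is_derive t 1 (fun s => f s - c) a.
Proof.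
move=> fa; rewrite -[a]subr0; apply: is_derive_subfun => //; exact: is_derive_cst.
Qed.

Lemma is_derive_mulfun f g t a b : is_derive t 1 f a -> is_derive t 1 g b ->
  is_derive t 1 (fun s => f s * g s) (a * g t + f t * b).
Proof.
move=> fa gb; apply: (is_derive_eq (is_deriveM fa gb)).
by rewrite /GRing.scale /= addrC; congr (_ + _); rewrite mulrC.
Qed.

Lemma is_derive_divfun f g t a b : g t != 0 ->
  is_derive t 1 f a -> is_derive t 1 g b ->
  is_derive t 1 (fun s => f s / g s) ((a * g t - f t * b) / g t ^+ 2).
Proof.
move=> g0 fa gb; have := is_deriveV g0 gb => dV.
apply: (is_derive_eq (is_derive_mulfun fa dV)).
by rewrite /GRing.scale /=; field.
Qed.

Lemma is_derive_divcst f t a (c : R) : is_derive t 1 f a ->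
  is_derive t 1 (fun s => f s / c) (a / c).
Proof.
move=> fa; apply: (is_derive_eq (is_derive_mulfun fa (is_derive_cst _ _ _))).
by rewrite mulr0 addr0.
Qed.

Lemma is_derive_compfun (F : R -> R) f t a b : is_derive (f t) 1 F b ->
  is_derive t 1 f a -> is_derive t 1 (fun s => F (f s)) (b * a).
Proof. by move=> Fb fa; exact: is_derive1_comp. Qed.

End DerivativeRules.

(** * Contour integrals and winding numbers *)

Section Winding.
Variable R : realType.
Implicit Types (G : closed_contour R) (z : R[i]) (f : R[i] -> R[i]).

Definition contour_cts G f : Prop :=
  forall k : 'I_(narcs G), cts01 (fun t => f (arc_pt (Defs.arc k) t)).

Lemma eq_contour_integral G f g :
  (forall z, on_contour G z -> f z = g z) ->
  contour_integral G f = contour_integral G g.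
Proof.
move=> fg; apply: eq_bigr => k _; apply: eq_integral01 => t t01; rewrite fg //.
by exists k, t; split => //; move: t01; rewrite in_itv.
Qed.

Lemma contour_integral_linear G (I : Type) (r : seq I) (c : I -> R[i])
    (f : I -> R[i] -> R[i]) :
  (forall i, contour_cts G (f i)) ->
  contour_integral G (fun z => \sum_(i <- r) c i * f i z) =
  \sum_(i <- r) c i * contour_integral G (f i).
Proof.
move=> cf.
have cfv i (k : 'I_(narcs G)) :
    cts01 (fun t => f i (arc_pt (Defs.arc k) t) * arc_vel (Defs.arc k) t).
  by apply: cts01M; [exact: cf|exact: arc_vel_cts].
suff arcE (k : 'I_(narcs G)) :
    cts01 (fun t => (\sum_(i <- r) c i * f i (arc_pt (Defs.arc k) t)) *
      arc_vel (Defs.arc k) t) /\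
    integral01 (fun t => (\sum_(i <- r) c i * f i (arc_pt (Defs.arc k) t)) *
      arc_vel (Defs.arc k) t) =
    \sum_(i <- r) c i * integral01 (fun t => f i (arc_pt (Defs.arc k) t) *
      arc_vel (Defs.arc k) t).
  rewrite /contour_integral (eq_bigr _ (fun k _ => (arcE k).2)) exchange_big /=.
  by apply: eq_bigr => i _; rewrite mulr_sumr.
elim: r => [|i r [IHc IHe]].
  have e0 : (fun t => (\sum_(i <- [::]) c i * f i (arc_pt (Defs.arc k) t)) *
      arc_vel (Defs.arc k) t) = (fun=> 0).
    by apply/funext => t; rewrite big_nil mul0r.
  rewrite e0 big_nil; split; first exact: cts01_cst.
  rewrite -[RHS](mul0r (integral01 (fun=> 0))) -integral01Z; last exact: cts01_cst.
  by apply: eq_integral01 => t _; rewrite mul0r.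
have e1 : (fun t => (\sum_(j <- i :: r) c j * f j (arc_pt (Defs.arc k) t)) *
      arc_vel (Defs.arc k) t) =
    (fun t => c i * (f i (arc_pt (Defs.arc k) t) * arc_vel (Defs.arc k) t) +
      (\sum_(j <- r) c j * f j (arc_pt (Defs.arc k) t)) * arc_vel (Defs.arc k) t).
  by apply/funext => t; rewrite big_cons mulrDl mulrA.
have ci : cts01 (fun t => c i * (f i (arc_pt (Defs.arc k) t) * arc_vel (Defs.arc k) t)).
  by apply: cts01M => //; exact: cts01_cst.
rewrite e1 big_cons; split; first exact: cts01D.
by rewrite integral01D // integral01Z // IHe.
Qed.

(** The increments of the primitive along the arcs telescope, since the arcs form a
    cycle. *)
Lemma contour_integral_primitive G f (F : R[i] -> R[i]) :
  (forall k : 'I_(narcs G),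
     integral01 (fun t => f (arc_pt (Defs.arc k) t) * arc_vel (Defs.arc k) t) =
     F (arc_pt (Defs.arc k) 1) - F (arc_pt (Defs.arc k) 0)) ->
  contour_integral G f = 0.
Proof.
move=> fF; rewrite /contour_integral (eq_bigr _ (fun k _ => fF k)).
rewrite sumrB (eq_bigr (fun k => F (arc_pt (Defs.arc (ordS k)) 0))); last first.
  by move=> k _; rewrite arc_chain.
have ordS_on : {on [pred i : 'I_(narcs G) | true], bijective (@ordS (narcs G))}.
  by exists (@ord_pred _) => k _; rewrite ?ordSK ?ord_predK.
apply/eqP; rewrite subr_eq0; apply/eqP; symmetry.
exact: (reindex (@ordS (narcs G)) ordS_on).
Qed.

Lemma contour_cts_resolvent G z : ~ on_contour G z ->
  contour_cts G (fun zeta => (zeta - z)^-1).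
Proof.
move=> Gz k; apply: cts01V.
  by apply: cts01D; [exact: arc_pt_cts|exact: cts01_cst].
move=> t; rewrite in_itv /= => t01; rewrite subr_eq0; apply/eqP => e.
by apply: Gz; exists k, t.
Qed.

(** The real and imaginary parts of [a * conj b]; dividing by [re_dot b b] gives those
    of [a / b]. *)
Definition re_dot (a b : R[i]) : R :=
  complex.Re a * complex.Re b + complex.Im a * complex.Im b.

Definition im_dot (a b : R[i]) : R :=
  complex.Im a * complex.Re b - complex.Re a * complex.Im b.

(** The principal logarithm of [(zeta - z') / (zeta - z)], written with [atan] and thus
    correct only where this quotient has positive real part. *)
Definition log_ratio (z z' zeta : R[i]) : R[i] :=
  let a := zeta - z' in let b := zeta - z in
  ((ln (re_dot a a) - ln (re_dot b b)) / 2) +i* atan (im_dot a b / re_dot a b).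

(** The positivity assumption says that the quotient [(zeta - z') / (zeta - z)] stays in
    the right half plane along the arc, where its principal logarithm is a primitive
    of the integrand; both parts are then instances of the real fundamental theorem. *)
Lemma integral01_log_ratio (g : C1_arc R) z z' :
  (forall t : R, 0 <= t <= 1 -> 0 < re_dot (arc_pt g t - z') (arc_pt g t - z)) ->
  integral01 (fun t => ((arc_pt g t - z')^-1 - (arc_pt g t - z)^-1) * arc_vel g t) =
  log_ratio z z' (arc_pt g 1) - log_ratio z z' (arc_pt g 0).
Proof.
move=> pos.
pose x t := complex.Re (arc_pt g t); pose y t := complex.Im (arc_pt g t).
pose x' t := complex.Re (arc_vel g t); pose y' t := complex.Im (arc_vel g t).
pose c := complex.Re z; pose e := complex.Im z.
pose c' := complex.Re z'; pose e' := complex.Im z'.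
pose sq c e t := (x t - c) * (x t - c) + (y t - e) * (y t - e).
pose p t := (x t - c') * (x t - c) + (y t - e') * (y t - e).
pose q t := (y t - e') * (x t - c) - (x t - c') * (y t - e).
have pE t : re_dot (arc_pt g t - z') (arc_pt g t - z) = p t.
  by rewrite /re_dot !ReB !ImB.
have qE t : im_dot (arc_pt g t - z') (arc_pt g t - z) = q t.
  by rewrite /im_dot !ReB !ImB.
have sqE w t : re_dot (arc_pt g t - w) (arc_pt g t - w) =
    sq (complex.Re w) (complex.Im w) t.
  by rewrite /re_dot !ReB !ImB.
have p0 t : 0 <= t <= 1 -> 0 < p t by move=> /pos; rewrite pE.
have sqM t : sq c' e' t * sq c e t = p t ^+ 2 + q t ^+ 2.
  by rewrite /sq /p /q; ring.
have sq_ge0 a b t : 0 <= sq a b t by rewrite addr_ge0 // -expr2 sqr_ge0.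
have sq0 t : 0 <= t <= 1 -> 0 < sq c' e' t /\ 0 < sq c e t.
  move=> /p0 pt; have : 0 < sq c' e' t * sq c e t.
    by rewrite sqM ltr_pwDl ?sqr_ge0 // exprn_gt0.
  move: (sq_ge0 c' e' t) (sq_ge0 c e t); rewrite !le_eqVlt.
  by move=> /predU1P[<-|->] /predU1P[<-|->]; rewrite ?(mul0r, mulr0) ?ltxx.
have w01 := @within01_cst R.
have [cx cy] : {within `[0, 1], continuous x} /\ {within `[0, 1], continuous y}.
  exact: arc_pt_cts.
have cxc a : {within `[0, 1], continuous (fun t => x t - a)} by exact: within01D.
have cyc a : {within `[0, 1], continuous (fun t => y t - a)} by exact: within01D.
have csq a b : {within `[0, 1], continuous (sq a b)}.
  by apply: within01D; apply: within01M.
have cp : {within `[0, 1], continuous p}.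
  by apply: within01D; apply: within01M.
have cq : {within `[0, 1], continuous q}.
  by apply: within01D; [|apply: within01N]; apply: within01M.
have in01 (t : R) : t \in `[0, 1]%R -> 0 <= t <= 1 by rewrite in_itv.
have oo01 (t : R) : 0 < t < 1 -> 0 <= t <= 1.
  by move=> /andP[t0 t1]; rewrite !ltW.
have cln a b : (forall t, 0 <= t <= 1 -> 0 < sq a b t) ->
    {within `[0, 1], continuous (fun t => ln (sq a b t))}.
  by move=> s0; apply: within01_comp => // t /in01 /s0; exact: continuous_ln.
have [cv1 cv2] : cts01 (fun t =>
    ((arc_pt g t - z')^-1 - (arc_pt g t - z)^-1) * arc_vel g t).
  have cV w : (forall t, 0 <= t <= 1 -> 0 < sq (complex.Re w) (complex.Im w) t) ->
      cts01 (fun t => (arc_pt g t - w)^-1).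
    move=> s0; apply: cts01V.
      by apply: cts01D; [exact: arc_pt_cts|exact: cts01_cst].
    move=> t /in01 /s0; rewrite -sqE; apply: contraTneq => ->.
    by rewrite /re_dot /= !mul0r addr0 ltxx.
  apply: cts01M; last exact: arc_vel_cts.
  have [h1 h2] : cts01 (fun t => -1 * (arc_pt g t - z)^-1).
    by apply: cts01M; [exact: cts01_cst|apply: cV => t /sq0[]].
  have -> : (fun t => (arc_pt g t - z')^-1 - (arc_pt g t - z)^-1) =
     (fun t => (arc_pt g t - z')^-1 + -1 * (arc_pt g t - z)^-1).
    by apply/funext => t; rewrite mulN1r.
  by apply: cts01D => //; apply: cV => t /sq0[].
have dx (t : R) : 0 < t < 1 -> is_derive t 1 x (x' t) by move=> /(arc_velP g)[].
have dy (t : R) : 0 < t < 1 -> is_derive t 1 y (y' t) by move=> /(arc_velP g)[].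
have dsq a b (t : R) : 0 < t < 1 -> is_derive t 1 (sq a b)
    (2 * ((x t - a) * x' t + (y t - b) * y' t)).
  move=> t01; have dxa := is_derive_shift a (dx t t01).
  have dyb := is_derive_shift b (dy t t01).
  apply: (is_derive_eq (is_derive_addfun (is_derive_mulfun dxa dxa)
    (is_derive_mulfun dyb dyb))).
  by ring.
have cF1 : {within `[0, 1], continuous (fun t => (ln (sq c' e' t) - ln (sq c e t)) / 2)}.
  by apply: within01M => //; apply: within01D; [|apply: within01N];
    apply: cln => t /sq0[].
have cF2 : {within `[0, 1], continuous (fun t => atan (q t / p t))}.
  apply: within01_comp; last by move=> t _; exact: continuous_atan.
  apply: within01M => //; apply: within01V => // t /in01 /p0.
  exact: lt0r_neq0.
have dF1 (t : R) : 0 < t < 1 ->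
    is_derive t 1 (fun t => (ln (sq c' e' t) - ln (sq c e t)) / 2)
      (complex.Re (((arc_pt g t - z')^-1 - (arc_pt g t - z)^-1) * arc_vel g t)).
  move=> t01; have [s1 s2] := sq0 t (oo01 t t01).
  apply: (is_derive_eq (is_derive_divcst 2 (is_derive_subfun
    (is_derive_compfun (is_derive1_ln s1) (dsq c' e' t t01))
    (is_derive_compfun (is_derive1_ln s2) (dsq c e t t01))))).
  rewrite ReM ReB ImB !ReV !ImV !ReB !ImB.
  rewrite -/(x t) -/(y t) -/(x' t) -/(y' t) -/c -/c' -/e -/e'.
  rewrite /sq !expr2 in s1 s2 *.
  field.
  by rewrite !lt0r_neq0.
have dF2 (t : R) : 0 < t < 1 ->
    is_derive t 1 (fun t => atan (q t / p t))
      (complex.Im (((arc_pt g t - z')^-1 - (arc_pt g t - z)^-1) * arc_vel g t)).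
  move=> t01; have pt := p0 t (oo01 t t01).
  have [s1 s2] := sq0 t (oo01 t t01).
  have dxa a := is_derive_shift a (dx t t01).
  have dya a := is_derive_shift a (dy t t01).
  have dp := is_derive_addfun (is_derive_mulfun (dxa c') (dxa c))
    (is_derive_mulfun (dya e') (dya e)).
  have dq := is_derive_subfun (is_derive_mulfun (dya e') (dxa c))
    (is_derive_mulfun (dxa c') (dya e)).
  apply: (is_derive_eq (is_derive_compfun (is_derive1_atan _)
    (is_derive_divfun (f := q) (g := p) (lt0r_neq0 pt) dq dp))).
  rewrite ImM ReB ImB !ReV !ImV !ReB !ImB.
  rewrite -/(x t) -/(y t) -/(x' t) -/(y' t) -/c -/c' -/e -/e'.
  (* By Lagrange's identity the derivative of [atan (q / p)] loses its denominator in p. *)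
  have den : (1 + (q t / p t) ^+ 2)^-1 = p t ^+ 2 / (sq c' e' t * sq c e t).
    rewrite sqM; field.
    by rewrite (lt0r_neq0 pt) lt0r_neq0 // ltr_pwDl ?sqr_ge0 ?exprn_gt0.
  have cancel_p n : p t ^+ 2 / (sq c' e' t * sq c e t) * (n / p t ^+ 2) =
      n / (sq c' e' t * sq c e t).
    by field; rewrite !lt0r_neq0.
  rewrite den cancel_p /p /q /sq !expr2 in s1 s2 *.
  field.
  by rewrite !lt0r_neq0.
rewrite /integral01 (within01_FTC cv1 cF1 dF1) (within01_FTC cv2 cF2 dF2).
apply: complex_parts_eq; rewrite ?ReB ?ImB /log_ratio /= ?qE ?pE //.
by rewrite !sqE.
Qed.

Lemma normc_ge0 (z : R[i]) : 0 <= Normc.normc z.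
Proof. by case: z => a b; exact: sqrtr_ge0. Qed.

Lemma re_dot_lagrange (a b : R[i]) :
  re_dot a b ^+ 2 + im_dot a b ^+ 2 = re_dot a a * re_dot b b.
Proof. by rewrite /re_dot /im_dot; ring. Qed.

Lemma re_dot_self (a : R[i]) : re_dot a a = Normc.normc a ^+ 2.
Proof.
by case: a => x y; rewrite /re_dot /= sqr_sqrtr ?addr_ge0 ?sqr_ge0.
Qed.

(** Cauchy-Schwarz: a perturbation shorter than [b] keeps [b] in the half plane
    around it. *)
Lemma re_dot_sub_gt0 (w b : R[i]) :
  re_dot w w < re_dot b b -> 0 < re_dot (b - w) b.
Proof.
move=> wb; have -> : re_dot (b - w) b = re_dot b b - re_dot w b.
  by rewrite /re_dot !ReB !ImB; ring.
rewrite subr_gt0.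
have w0 : 0 <= re_dot w w by rewrite re_dot_self sqr_ge0.
have b0 : 0 < re_dot b b by exact: le_lt_trans wb.
apply: (le_lt_trans (ler_norm _)).
rewrite -ltr_sqr ?nnegrE ?normr_ge0 ?ltW // real_normK ?num_real //.
apply: (@le_lt_trans _ _ (re_dot w w * re_dot b b)).
  by rewrite -re_dot_lagrange lerDl sqr_ge0.
by rewrite expr2 ltr_pM2r.
Qed.

(** A continuous positive function has a positive minimum on each of the finitely many
    compact arcs. *)
Lemma contour_dist G z : ~ on_contour G z ->
  exists2 delta : R, 0 < delta &
    forall zeta, on_contour G zeta -> delta ^+ 2 <= re_dot (zeta - z) (zeta - z).
Proof.
move=> Gz.
have arc_dist (k : 'I_(narcs G)) : exists delta : R, 0 < delta /\
    forall t : R, 0 <= t <= 1 ->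
      delta ^+ 2 <= re_dot (arc_pt (Defs.arc k) t - z) (arc_pt (Defs.arc k) t - z).
  have [cx cy] := arc_pt_cts (Defs.arc k).
  have cd : {within `[0, 1], continuous
      (fun t => re_dot (arc_pt (Defs.arc k) t - z) (arc_pt (Defs.arc k) t - z))}.
    have -> : (fun t => re_dot (arc_pt (Defs.arc k) t - z) (arc_pt (Defs.arc k) t - z)) =
      (fun t => (complex.Re (arc_pt (Defs.arc k) t) - complex.Re z) *
                (complex.Re (arc_pt (Defs.arc k) t) - complex.Re z) +
                (complex.Im (arc_pt (Defs.arc k) t) - complex.Im z) *
                (complex.Im (arc_pt (Defs.arc k) t) - complex.Im z)).
      by apply/funext => t; rewrite /re_dot ReB ImB.
    by apply: within01D; apply: within01M; apply: within01D => //; exact: within01_cst.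
  have [t0 t001 tmin] := EVT_min ler01 cd.
  have off : arc_pt (Defs.arc k) t0 - z != 0.
    rewrite subr_eq0; apply/eqP => e; apply: Gz; by exists k, t0.
  exists (Normc.normc (arc_pt (Defs.arc k) t0 - z)); split.
    rewrite lt_neqAle eq_sym normc_ge0 andbT.
    by apply: contra off => /eqP/Normc.eq0_normc ->.
  by move=> t t01; rewrite -re_dot_self tmin ?in_itv.
have [d dP] := boolp.choice arc_dist.
exists (\big[Num.min/1]_k d k).
  by apply/bigmin_gtP; split => // k _; case: (dP k).
move=> _ [k [t [t01 <-]]]; have [dk0 dkP] := dP k; apply: le_trans (dkP t t01).
have m0 : 0 < \big[Num.min/1]_k d k by apply/bigmin_gtP; split => // j _; case: (dP j).
by rewrite ler_sqr ?nnegrE ?(ltW m0) ?(ltW dk0) // bigmin_le_cond.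
Qed.

(** When [z'] is closer to [z] than the contour is, [(zeta - z') / (zeta - z)] has
    positive real part on the contour, and the difference of the two integrands has
    a primitive there. *)
Lemma winding_number_locally_constant G z : ~ on_contour G z ->
  exists2 delta : R, 0 < delta &
    forall z', Normc.normc (z' - z) < delta ->
      ~ on_contour G z' /\ winding_number G z' = winding_number G z.
Proof.
move=> Gz; have [delta d0 dP] := contour_dist Gz.
exists delta => // z' z'z.
have near_z zeta : on_contour G zeta -> re_dot (z' - z) (z' - z) < re_dot (zeta - z) (zeta - z).
  move=> /dP; apply: lt_le_trans; by rewrite re_dot_self ltr_sqr ?nnegrE ?normc_ge0 ?(ltW d0).
have Gz' : ~ on_contour G z' by move=> /near_z; rewrite ltxx.
split=> //; rewrite /winding_number; congr (_ * _); apply/eqP; rewrite -subr_eq0.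
pose s b : R[i] := if b then 1 else -1; pose w b := if b then z' else z.
have cw b : contour_cts G (fun zeta => (zeta - w b)^-1).
  by case: b; exact: contour_cts_resolvent.
have := contour_integral_linear [:: true; false] s cw.
rewrite !big_cons !big_nil !addr0 /s /w mul1r mulN1r => <-.
apply/eqP/(contour_integral_primitive (F := log_ratio z z')) => k.
rewrite -integral01_log_ratio.
  by apply: eq_integral01 => t _; rewrite !big_cons big_nil addr0 mul1r mulN1r.
move=> t t01; have -> : arc_pt (Defs.arc k) t - z' =
   (arc_pt (Defs.arc k) t - z) - (z' - z) by rewrite opprB addrA subrK.
by apply: re_dot_sub_gt0; apply: near_z; exists k, t.
Qed.

End Winding.

(** * A submultiplicative norm of complex matrices *)

Section MatrixNorm.
Variable R : realType.
Implicit Types (m n p : nat).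

(** The sum of the moduli, with values in the real field, is submultiplicative without
    a factor depending on the size, also for rectangular matrices. *)
Definition mnorm m n (M : 'M[R[i]]_(m, n)) : R :=
  \sum_i \sum_j Normc.normc (M i j).

Lemma mnorm_ge0 m n (M : 'M[R[i]]_(m, n)) : 0 <= mnorm M.
Proof. by apply: sumr_ge0 => i _; apply: sumr_ge0 => j _; exact: normc_ge0. Qed.

Lemma normc_le_mnorm m n (M : 'M[R[i]]_(m, n)) i j : Normc.normc (M i j) <= mnorm M.
Proof.
rewrite /mnorm (bigD1 i) //= (bigD1 j) //= -addrA lerDl addr_ge0 //.
  by apply: sumr_ge0 => k _; exact: normc_ge0.
by apply: sumr_ge0 => k _; apply: sumr_ge0 => l _; exact: normc_ge0.
Qed.

Lemma mnorm_eq0 m n (M : 'M[R[i]]_(m, n)) : mnorm M <= 0 -> M = 0.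
Proof.
move=> M0; apply/matrixP => i j; rewrite mxE; apply: Normc.eq0_normc.
by apply/le_anti; rewrite normc_ge0 (le_trans (normc_le_mnorm M i j) M0).
Qed.

Lemma normcR (x : R) : Normc.normc x%:C = `|x|.
Proof. by rewrite /= expr0n addr0 sqrtr_sqr. Qed.

Lemma normcD (x y : R[i]) : Normc.normc (x + y) <= Normc.normc x + Normc.normc y.
Proof. exact: (@le_normcD R). Qed.

Lemma normc_sum (I : Type) (r : seq I) (F : I -> R[i]) :
  Normc.normc (\sum_(i <- r) F i) <= \sum_(i <- r) Normc.normc (F i).
Proof.
elim: r => [|i r IH]; first by rewrite !big_nil Normc.normc0.
by rewrite !big_cons (le_trans (normcD _ _)) // lerD2l.
Qed.

Lemma mnormD m n (M M' : 'M[R[i]]_(m, n)) : mnorm (M + M') <= mnorm M + mnorm M'.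
Proof.
rewrite /mnorm -big_split; apply: ler_sum => i _; rewrite -big_split.
by apply: ler_sum => j _; rewrite mxE normcD.
Qed.

Lemma mnormN m n (M : 'M[R[i]]_(m, n)) : mnorm (- M) = mnorm M.
Proof. by apply: eq_bigr => i _; apply: eq_bigr => j _; rewrite mxE (@normcN R). Qed.

Lemma mnormM m n p (M : 'M[R[i]]_(m, n)) (M' : 'M[R[i]]_(n, p)) :
  mnorm (M *m M') <= mnorm M * mnorm M'.
Proof.
rewrite /mnorm mulr_suml; apply: ler_sum => i _.
apply: (@le_trans _ _ (\sum_j \sum_k Normc.normc (M i k) * Normc.normc (M' k j))).
  apply: ler_sum => j _; rewrite mxE (le_trans (normc_sum _ _)) //.
  by apply: ler_sum => k _; rewrite Normc.normcM.
rewrite exchange_big /= mulr_suml; apply: ler_sum => k _.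
rewrite -mulr_sumr ler_wpM2l ?normc_ge0 //.
rewrite (bigD1 (P := predT) k) //= lerDl.
by apply: sumr_ge0 => l _; apply: sumr_ge0 => j _; exact: normc_ge0.
Qed.

Lemma mnorm_diag_le n (d : 'rV[R[i]]_n) (e : R) :
  (forall j, Normc.normc (d 0 j) <= e) -> mnorm (diag_mx d) <= n%:R * e.
Proof.
move=> de; rewrite /mnorm.
apply: (@le_trans _ _ (\sum_(i < n) e)); last first.
  by rewrite sumr_const card_ord mulr_natl.
apply: ler_sum => i _; rewrite (bigD1 i) //= mxE eqxx mulr1n.
rewrite big1 ?addr0 // => j /negPf ij.
by rewrite mxE eq_sym ij mulr0n Normc.normc0.
Qed.

Lemma mnorm_unitary n (V : 'M[R[i]]_n) : V \is unitarymx -> mnorm V <= (n * n)%:R.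
Proof.
move=> /unitarymxP V1; rewrite /mnorm.
have Vij i j : Normc.normc (V i j) <= 1.
  have := congr1 (fun M : 'M[R[i]]_n => complex.Re (M i i)) V1.
  rewrite !mxE eqxx /= => Vi.
  have ReE k : complex.Re (V i k * (V ^t* ) k i) = Normc.normc (V i k) ^+ 2.
    rewrite !mxE -re_dot_self /re_dot; case: (V i k) => a b.
    by rewrite /= mulrN opprK.
  have {Vi} Vi : \sum_k Normc.normc (V i k) ^+ 2 = 1.
    rewrite -[RHS]Vi (raddf_sum (@complex.Re R : Rcomplex R -> R)).
    by apply: eq_bigr => k _; rewrite -ReE.
  rewrite -(@ler_pXn2r _ 2) ?nnegrE ?normc_ge0 // expr1n -Vi (bigD1 j) //= lerDl.
  by apply: sumr_ge0 => k _; exact: sqr_ge0.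
apply: (@le_trans _ _ (\sum_(i < n) \sum_(j < n) 1)).
  by apply: ler_sum => i _; apply: ler_sum => j _.
by rewrite !sumr_const !card_ord -mulrnA.
Qed.

End MatrixNorm.

(** * The Riesz projector of a diagonalised matrix *)

Section DiagonalConjugates.
Variable R : realType.
Variable N : nat.
Implicit Types (V : 'M[R[i]]_N) (d : 'rV[R[i]]_N).

Definition diag_conj V d : 'M[R[i]]_N := invmx V *m diag_mx d *m V.

Lemma diag_conj_entry V d i j :
  diag_conj V d i j = \sum_l (invmx V i l * V l j) * d 0 l.
Proof.
by rewrite mxE; apply: eq_bigr => l _; rewrite mul_mx_diag mxE mulrAC.
Qed.

Lemma diag_conjB V d d' : diag_conj V d - diag_conj V d' = diag_conj V (d - d').
Proof.
have dB (X Y d1 d2 : 'M[R[i]]_N) :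
    X *m d1 *m Y - X *m d2 *m Y = X *m (d1 - d2) *m Y by rewrite mulmxBr mulmxBl.
by rewrite /diag_conj dB -linearB.
Qed.

Lemma diag_conj_scalar V a : V \in unitmx -> a%:M = diag_conj V (const_mx a).
Proof.
move=> Vu; rewrite /diag_conj diag_const_mx -mulmxA mul_scalar_mx -scalemxAr.
by rewrite mulVmx // scalemx1.
Qed.

Lemma diag_conj_mul V d d' : V \in unitmx ->
  diag_conj V d *m diag_conj V d' = diag_conj V (\row_j (d 0 j * d' 0 j)).
Proof.
move=> Vu.
have cancel_mid (X V' Y d1 d2 : 'M[R[i]]_N) : V' *m Y = 1%:M ->
    X *m d1 *m V' *m (Y *m d2 *m V') = X *m (d1 *m d2) *m V'.
  by move=> VY; rewrite -!mulmxA (mulmxA V') VY mul1mx.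
rewrite /diag_conj (cancel_mid _ _ _ _ _ (mulmxV Vu)) mulmx_diag; reflexivity.
Qed.

Lemma mnorm_diag_conj V d (a : R) : V \is unitarymx -> invmx V \is unitarymx ->
  0 <= a -> (forall j, Normc.normc (d 0 j) <= a) ->
  mnorm (diag_conj V d) <= a * ((N * N)%:R * (N%:R * (N * N)%:R)).
Proof.
move=> Vun Viun a0 da; rewrite /diag_conj; apply: le_trans (mnormM _ _) _.
have V1 := mnorm_unitary Vun; have V2 := mnorm_unitary Viun.
have d1 := mnorm_diag_le da; have V0 := mnorm_ge0 V.
apply: (@le_trans _ _ ((N * N)%:R * (N%:R * a) * (N * N)%:R)); last first.
  by rewrite le_eqVlt; apply/orP; left; apply/eqP; ring.
apply: ler_pM => //; first exact: mnorm_ge0.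
apply: le_trans (mnormM _ _) _.
by apply: ler_pM => //; exact: mnorm_ge0.
Qed.

Lemma diag_conj_inverse V d : V \in unitmx -> (forall j, d 0 j != 0) ->
  invmx (diag_conj V d) = diag_conj V (\row_j (d 0 j)^-1).
Proof.
move=> Vu d0.
have e1 : diag_conj V (\row_j (d 0 j)^-1) *m diag_conj V d = 1%:M.
  rewrite diag_conj_mul // (diag_conj_scalar 1 Vu); congr (diag_conj V _).
  by apply/rowP => j; rewrite !mxE mulVf.
have [_ Mu] := mulmx1_unit e1.
by rewrite (canRL (mulmxK Mu) e1) mul1mx.
Qed.

End DiagonalConjugates.

Section RieszProjector.
Variable R : realType.
Implicit Types (N : nat) (G : closed_contour R).

(** In a diagonalising basis the resolvent is diagonal, so each entry of the projector
    is a linear combination of integrals of [(zeta - D_l)^-1]. *)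
Lemma riesz_projector_diag N G (M V : 'M[R[i]]_N) (D : 'rV[R[i]]_N) :
  V \in unitmx -> M = diag_conj V D ->
  (forall j, ~ on_contour G (D 0 j)) ->
  riesz_projector G M =
  diag_conj V (\row_j winding_number G (D 0 j)).
Proof.
move=> Vu MD GD.
have resolventE zeta : on_contour G zeta ->
    invmx (M - zeta%:M) = diag_conj V (\row_l (D 0 l - zeta)^-1).
  move=> Gz; rewrite MD (diag_conj_scalar zeta Vu) diag_conjB.
  have D0 j : (D - const_mx zeta) 0 j != 0.
    by rewrite !mxE subr_eq0; apply: contra_not_neq (GD j) => ->.
  rewrite (diag_conj_inverse Vu D0); congr (diag_conj V _).
  by apply/rowP => l; rewrite !mxE.
rewrite /riesz_projector; apply/matrixP => i j; rewrite diag_conj_entry !mxE.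
rewrite (eq_contour_integral (g := fun zeta =>
    \sum_l (- (invmx V i l * V l j)) * (zeta - D 0 l)^-1)); last first.
  move=> zeta Gz; rewrite (resolventE _ Gz) diag_conj_entry; apply: eq_bigr => l _.
  by rewrite !mxE -opprB invrN mulrN mulNr.
rewrite contour_integral_linear; last by move=> l; exact: contour_cts_resolvent.
rewrite mulr_sumr; apply: eq_bigr => l _; rewrite !mxE /winding_number.
by rewrite !mulNr mul1r mulrN opprK mulrCA.
Qed.

Lemma hermitian_diagonalization N (M : 'M[R[i]]_N) : M \is hermsymmx ->
  exists V D, [/\ V \is unitarymx, invmx V \is unitarymx, V \in unitmx &
    M = diag_conj V D].
Proof.
move=> /hermitian_normalmx /orthomx_spectralP Me.
exists (spectralmx M), (spectral_diag M); split => //.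
- exact: spectral_unitarymx.
- by rewrite invmx_unitary ?trmxC_unitary ?spectral_unitarymx.
- exact: spectral_unit.
Qed.

Lemma diagonalization_eigenvalue N (M V : 'M[R[i]]_N) (D : 'rV[R[i]]_N) j :
  V \in unitmx -> M = diag_conj V D -> eigenvalue M (D 0 j).
Proof.
move=> Vu ->; apply/eigenvalueP; exists (row j V).
  by rewrite /diag_conj !mulmxA -row_mul mulmxV // row1 -rowE row_diag_mx -scalemxAl -rowE.
apply: contraTneq Vu => Vj; rewrite -row_free_unit -kermx_eq0.
have : (delta_mx 0 j : 'rV[R[i]]_N) *m V = 0 by rewrite -rowE.
move=> /sub_kermxP; apply: contraTN => /eqP ->; rewrite submx0.
by apply/eqP => /matrixP /(_ 0 j); rewrite !mxE !eqxx /=; apply/eqP; rewrite oner_eq0.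
Qed.

(** Gershgorin's argument in the eigenbasis of [M0]: one looks at the largest
    coordinate of an eigenvector of [M]. *)
Lemma eigenvalue_perturbation N (M M0 V : 'M[R[i]]_N) (D : 'rV[R[i]]_N) z :
  V \in unitmx -> M0 = diag_conj V D -> eigenvalue M z ->
  exists l, Normc.normc (z - D 0 l) <= mnorm V * mnorm (M - M0) * mnorm (invmx V).
Proof.
move=> Vu M0e /eigenvalueP[v vM v0].
pose u := v *m invmx V; pose E := V *m (M - M0) *m invmx V.
have uE : u *m E = z *: u - u *m diag_mx D.
  rewrite /u /E !mulmxA mulmxKV // mulmxBr vM mulmxBl -scalemxAl; congr (_ - _).
  by rewrite M0e /diag_conj !mulmxA mulmxK.
have /rV0Pn[i0 ui0] : u != 0.
  by apply: contraNneq v0 => u0; rewrite -[v](mulmxKV Vu) -/u u0 mul0mx.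
have [l lmax] : exists l, forall k, Normc.normc (u 0 k) <= Normc.normc (u 0 l).
  have := @Order.TotalTheory.arg_maxP _ _ _ i0 xpredT (fun k => Normc.normc (u 0 k)) isT.
  by case=> l _ lmax; exists l => k; exact: lmax.
have ul0 : 0 < Normc.normc (u 0 l).
  apply: lt_le_trans (lmax i0); rewrite lt_neqAle eq_sym normc_ge0 andbT.
  by apply: contra ui0 => /eqP/Normc.eq0_normc ->.
exists l; apply: (@le_trans _ _ (mnorm E)); last first.
  apply: le_trans (mnormM _ _) _; rewrite ler_wpM2r ?mnorm_ge0 //.
  exact: mnormM.
rewrite -(ler_pM2r ul0) -Normc.normcM.
have -> : (z - D 0 l) * u 0 l = \sum_k u 0 k * E k l.
  have := congr1 (fun w : 'rV[R[i]]_N => w 0 l) uE.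
  rewrite mul_mx_diag !mxE => ->; by rewrite mulrBl [D 0 l * _]mulrC.
apply: le_trans (normc_sum _ _) _.
apply: (@le_trans _ _ (\sum_k Normc.normc (E k l) * Normc.normc (u 0 l))).
  apply: ler_sum => k _; rewrite Normc.normcM mulrC ler_wpM2l ?normc_ge0 //.
rewrite -mulr_suml ler_wpM2r ?normc_ge0 //; apply: ler_sum => k _.
rewrite (bigD1 l) //= lerDl; apply: sumr_ge0 => j _; exact: normc_ge0.
Qed.

End RieszProjector.

(** * The Riesz projector of a nearby matrix *)

Section Perturbation.
Variable R : realType.
Implicit Types (N m : nat) (G : closed_contour R).

(** With [eta] at most half the distance from [l0] to the rest of the spectrum, and small
    enough for the winding number to be constant around each eigenvalue, a point within
    [eta] of the spectrum is either close to [l0], where the winding number is 1, or at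
    distance at least [eta] from it, where the winding number is 0. *)
Lemma winding_separation N G (M V : 'M[R[i]]_N) (D : 'rV[R[i]]_N) l0 :
  V \in unitmx -> M = diag_conj V D -> encircles_only G M l0 ->
  exists2 eta0 : R, 0 < eta0 & forall eta z l, 0 < eta -> eta <= eta0 ->
    Normc.normc (z - D 0 l) < eta ->
    ~ on_contour G z /\
    (Normc.normc (z - l0) < eta /\ winding_number G z = 1 \/
     eta <= Normc.normc (z - l0) /\ winding_number G z = 0).
Proof.
move=> Vu Me enc.
have encD l := enc _ (diagonalization_eigenvalue l Vu Me).
have radius l : exists d : R, 0 < d /\ forall z, Normc.normc (z - D 0 l) < d ->
    ~ on_contour G z /\ winding_number G z = winding_number G (D 0 l).
  have [d d0 dP] := winding_number_locally_constant (encD l).1.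
  by exists d.
have [d dP] := boolp.choice radius.
pose gap l : R := if D 0 l == l0 then 1 else Normc.normc (D 0 l - l0) / 2.
exists (\big[Num.min/1]_l Num.min (d l) (gap l)).
  apply/bigmin_gtP; split=> // l _; rewrite lt_min (dP l).1 /gap /=.
  case: eqVneq => /= [_|Dl0]; rewrite ?ltr01 // divr_gt0 // lt_neqAle eq_sym normc_ge0 andbT.
  by apply: contra Dl0 => /eqP/Normc.eq0_normc/eqP; rewrite subr_eq0.
move=> eta z l eta0 eta_le zl.
have [etad etag] : eta <= d l /\ eta <= gap l.
  by apply/andP; rewrite -le_min (le_trans eta_le) // (bigmin_le _ l (fun l => Num.min (d l) (gap l))).
have [Gz wz] := (dP l).2 z (lt_le_trans zl etad).
split => //; rewrite wz (encD l).2; move: etag; rewrite /gap.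
case: eqVneq => [<- _|Dl0 gap2]; [by left|right; split => //].
have : Normc.normc (D 0 l - l0) <= Normc.normc (D 0 l - z) + Normc.normc (z - l0).
  by apply: le_trans (normcD _ _); rewrite addrA subrK.
rewrite -[Normc.normc (D 0 l - z)](@normcN R) opprB => tri.
move: gap2; rewrite ler_pdivlMr // mulr_natr mulr2n => gap2.
rewrite -(lerD2l eta) (le_trans gap2) // (le_trans tri) // lerD2r ltW //.
Qed.

Lemma eigenprojector_range N m (M P0 : 'M[R[i]]_N) l0 (W : 'M[R[i]]_(N, m)) :
  orthogonal_eigenprojector M l0 P0 -> P0 *m W = W -> (M - l0%:M) *m W = 0.
Proof.
move=> [_ _ P0range] P0W.
rewrite mulmxBl mul_scalar_mx; apply/eqP; rewrite subr_eq0; apply/eqP/matrixP => i j.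
have /P0range : exists w : 'cV[R[i]]_N, col j W = P0 *m w.
  by exists (col j W); rewrite colE mulmxA P0W.
by move=> /matrixP/(_ i 0); rewrite colE mulmxA scalemxAl -!colE !mxE.
Qed.

(** For [W] in the range of [Q] and the kernel of [P0],
    [W = S0 (M0 - l0) W = S0 ((M0 - M) W + (M - l0) Q W)], and [(M - l0) Q] is small
    since [Q] selects the eigenvalues close to [l0].  For [W] in the range of [P0] and
    the kernel of [Q], [W = T (M - l0) W = T (M - M0) W] where [T] inverts [M - l0] on
    the remaining eigenvalues, which stay at distance [eta] from [l0].  In both cases
    the norm of [W] is at most a proper fraction of itself. *)
Lemma riesz_projector_perturbation N G (M0 P0 S0 : 'M[R[i]]_N) l0 :
  M0 \is hermsymmx -> encircles_only G M0 l0 ->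
  orthogonal_eigenprojector M0 l0 P0 -> reduced_resolvent M0 l0 P0 S0 ->
  exists2 e : R, 0 < e & forall M : 'M[R[i]]_N, M \is hermsymmx ->
    mnorm (M - M0) < e -> let Q := riesz_projector G M in
    [/\ Q *m M = M *m Q, Q *m Q = Q,
        forall m (W : 'M[R[i]]_(N, m)), Q *m W = W -> P0 *m W = 0 -> W = 0 &
        forall m (W : 'M[R[i]]_(N, m)), P0 *m W = W -> Q *m W = 0 -> W = 0].
Proof.
move=> M0h enc P0_proj [_ _ _ S0M].
have [V0 [D0 [_ _ V0u M0e]]] := hermitian_diagonalization M0h.
have [eta0 eta0_gt0 sep] := winding_separation V0u M0e enc.
(* [c] bounds the norm of every unitary conjugate of a diagonal matrix with entries of
   modulus at most 1. *)
pose c : R := (N * N)%:R * (N%:R * (N * N)%:R).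
have c0 : 0 <= c by rewrite !mulr_ge0 // ler0n.
have s0 := mnorm_ge0 S0.
pose eta := Num.min eta0 (4 * (1 + mnorm S0) * (1 + c))^-1.
have a0 : 0 < 4 * (1 + mnorm S0) * (1 + c) by rewrite !mulr_gt0 ?ltr_pwDl.
have eta_gt0 : 0 < eta by rewrite lt_min eta0_gt0 invr_gt0.
have eta_le : eta <= eta0 by rewrite ge_min lexx.
have eta_le2 : eta * (4 * (1 + mnorm S0) * (1 + c)) <= 1.
  by rewrite -ler_pdivlMr // div1r ge_min lexx orbT.
have v0 := mnorm_ge0 V0; have vi0 := mnorm_ge0 (invmx V0).
pose b := (1 + mnorm V0) * (1 + mnorm (invmx V0)).
have b0 : 0 < b by rewrite mulr_gt0 ?ltr_pwDl.
(* The three bounds keep the eigenvalues of M within eta of those of M0, and make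
   the two linear estimates below strict contractions. *)
pose e := Num.min (eta / b) (Num.min (2 * (1 + mnorm S0))^-1 (eta / (2 * (1 + c)))).
have h1 : 0 < eta / b by rewrite divr_gt0.
have h2 : 0 < (2 * (1 + mnorm S0))^-1 by rewrite invr_gt0 mulr_gt0 ?ltr_pwDl.
have h3 : 0 < eta / (2 * (1 + c)) by rewrite divr_gt0 // mulr_gt0 ?ltr_pwDl.
exists e; first by rewrite !lt_min h1 h2 h3.
move=> M Mh Me Q.
have [V [D [Vun Viun Vu MVD]]] := hermitian_diagonalization Mh.
have [e1 [e2 e3]] : mnorm (M - M0) < eta / b /\ mnorm (M - M0) < (2 * (1 + mnorm S0))^-1
    /\ mnorm (M - M0) < eta / (2 * (1 + c)).
  by move: Me; rewrite !lt_min => /and3P[].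
have m0 := mnorm_ge0 (M - M0).
have spec j : ~ on_contour G (D 0 j) /\
    (Normc.normc (D 0 j - l0) < eta /\ winding_number G (D 0 j) = 1 \/
     eta <= Normc.normc (D 0 j - l0) /\ winding_number G (D 0 j) = 0).
  have [l lP] := eigenvalue_perturbation V0u M0e (diagonalization_eigenvalue j Vu MVD).
  apply: (sep _ _ l) => //; apply: le_lt_trans lP _.
  apply: (@le_lt_trans _ _ (mnorm (M - M0) * b)); last by rewrite -ltr_pdivlMr.
  by rewrite mulrAC mulrC ler_wpM2l // ler_pM // lerDr.
have QE : Q = diag_conj V (\row_j winding_number G (D 0 j)).
  exact: (riesz_projector_diag Vu MVD (fun j => (spec j).1)).
clearbody Q; have shiftE : M - l0%:M = diag_conj V (D - const_mx l0).
  by rewrite -(diag_conjB V D) -(diag_conj_scalar l0 Vu) -MVD.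
split.
- have c1 := diag_conj_mul (\row_j winding_number G (D 0 j)) D Vu.
  have c2 := diag_conj_mul D (\row_j winding_number G (D 0 j)) Vu.
  rewrite -MVD -QE in c1 c2; rewrite c1 c2; congr (diag_conj V _).
  by apply/rowP => j; rewrite !mxE mulrC.
- rewrite QE (diag_conj_mul _ _ Vu); congr (diag_conj V _); apply/rowP => j.
  by rewrite !mxE; case: (spec j) => _ [] [_ ->]; rewrite ?mulr1 ?mulr0.
- move=> m W QW P0W; apply: mnorm_eq0.
  have WE : W = S0 *m ((M0 - M) *m W + (M - l0%:M) *m Q *m W).
    rewrite -mulmxA QW -mulmxDl addrA subrK mulmxA S0M.
    by rewrite mulmxBl mul1mx P0W subr0.
  have MQ : mnorm ((M - l0%:M) *m Q) <= eta * c.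
    rewrite QE shiftE (diag_conj_mul _ _ Vu).
    apply: (mnorm_diag_conj Vun Viun (ltW eta_gt0)) => j.
    rewrite !mxE; case: (spec j) => _ [] [h ->]; rewrite ?mulr1 ?mulr0 ?Normc.normc0 ltW //.
  have := mnormM S0 ((M0 - M) *m W + (M - l0%:M) *m Q *m W).
  rewrite -WE => W1.
  have W2 : mnorm W <= mnorm S0 * (mnorm (M - M0) * mnorm W + eta * c * mnorm W).
    apply: le_trans W1 _; rewrite ler_wpM2l // (le_trans (mnormD _ _)) // lerD //.
      by rewrite (le_trans (mnormM _ _)) // -mnormN opprB.
    by rewrite (le_trans (mnormM _ _)) // ler_wpM2r ?mnorm_ge0.
  have W0 := mnorm_ge0 W.
  have small : mnorm S0 * mnorm (M - M0) + mnorm S0 * (eta * c) <= 3 / 4.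
    move: e2; rewrite -div1r ltr_pdivlMr ?mulr_gt0 ?ltr_pwDl // => e2.
    have := mulr_ge0 (ltW eta_gt0) s0; have := mulr_ge0 (ltW eta_gt0) c0.
    move: eta_le2 eta_gt0 m0; clear -e2; lra.
  move: W2; rewrite -mulrDl mulrA mulrDr => W2.
  have := ler_wpM2r W0 small; move: W2; clear; lra.
- move=> m W P0W QW; apply: mnorm_eq0.
  pose T := diag_conj V (\row_j
    (if Normc.normc (D 0 j - l0) < eta then 0 else (D 0 j - l0)^-1)).
  have TE : T *m (M - l0%:M) = 1%:M - Q.
    rewrite /T shiftE (diag_conj_mul _ _ Vu) QE (diag_conj_scalar 1 Vu) diag_conjB.
    congr (diag_conj V _); apply/rowP => j; rewrite !mxE.
    case: (spec j) => _ [] [h ->]; first by rewrite h mul0r subrr.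
    rewrite ltNge h /= subr0 mulVf //; apply: contraTneq h => ->.
    by rewrite Normc.normc0 -ltNge.
  have M0W := eigenprojector_range P0_proj P0W.
  have WE : W = T *m ((M - M0) *m W).
    have : T *m ((M - l0%:M) *m W) = W by rewrite mulmxA TE mulmxBl mul1mx QW subr0.
    by move=> {1}<-; rewrite -[M - l0%:M](subrK (M0 - l0%:M)) mulmxDl M0W addr0
      opprB addrA subrK.
  have Tn : mnorm T <= eta^-1 * c.
    apply: (mnorm_diag_conj Vun Viun) => [|j]; first by rewrite invr_ge0 ltW.
    rewrite mxE; case: ltP => h; first by rewrite Normc.normc0 invr_ge0 ltW.
    by rewrite Normc.normcV lef_pV2 // posrE (lt_le_trans eta_gt0).
  have W0 := mnorm_ge0 W.
  have W1 : mnorm W <= eta^-1 * c * (mnorm (M - M0) * mnorm W).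
    rewrite {1}WE (le_trans (mnormM _ _)) // ler_pM ?mnorm_ge0 //.
    exact: mnormM.
  move: e3; rewrite ltr_pdivlMr ?mulr_gt0 ?ltr_pwDl // => e3.
  have small : eta^-1 * c * mnorm (M - M0) <= 1 / 2.
    rewrite -mulrA mulrC ler_pdivrMr //; move: e3 m0 c0; clear; lra.
  have := ler_wpM2r W0 small; move: W1; rewrite mulrA; clear; lra.
Qed.
End Perturbation.

(** * The invariant subspace as a graph over the eigenspace *)

Section InvariantGraph.
Variable F : fieldType.

Lemma unitmx_of_injective n (C : 'M[F]_n) :
  (forall W : 'M[F]_n, C *m W = 0 -> W = 0) -> C \in unitmx.
Proof.
move=> C_inj; rewrite -row_full_unit -cokermx_eq0; apply/eqP/C_inj.
exact: mulmx_coker.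
Qed.

Variables N m : nat.
Variables (A Q P0 : 'M[F]_N) (U : 'M[F]_(N, m)) (L : 'M[F]_(m, N)).
Hypotheses (LU : L *m U = 1%:M) (UL : U *m L = P0).
Hypotheses (QA : Q *m A = A *m Q) (QQ : Q *m Q = Q).
Hypothesis Q_P0_inj :
  forall k (W : 'M[F]_(N, k)), Q *m W = W -> P0 *m W = 0 -> W = 0.
Hypothesis P0_Q_inj :
  forall k (W : 'M[F]_(N, k)), P0 *m W = W -> Q *m W = 0 -> W = 0.

Let C := L *m Q *m U.

Lemma compression_unit : C \in unitmx.
Proof.
apply: unitmx_of_injective => W CW.
have QUW : Q *m (U *m W) = 0.
  apply: Q_P0_inj; first by rewrite mulmxA QQ.
  by rewrite -UL -mulmxA (mulmxA L) (mulmxA (L *m Q)) -/C CW mulmx0.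
have UW : U *m W = 0.
  by apply: P0_Q_inj QUW; rewrite -UL -mulmxA (mulmxA L) LU mul1mx.
by rewrite -[W]mul1mx -LU -mulmxA UW mulmx0.
Qed.

Let K := (1%:M - P0) *m (Q *m U) *m invmx C.
Let B := L *m A *m (Q *m U) *m invmx C.

(** [T = Q U C^-1] satisfies [Q T = T] and [L T = 1], so [Q - T L Q] maps into the range
    of [Q] and the kernel of [P0] and vanishes.  Thus [Q] factors through [T], and
    [A T = Q A T = T L Q A T = T (L A T)]. *)
Lemma invariant_graph :
  [/\ L *m K = 0, A *m (U + K) = (U + K) *m B & B = L *m A *m (U + K)].
Proof.
pose T := Q *m U *m invmx C.
have LT : L *m T = 1%:M by rewrite /T !mulmxA mulmxV // compression_unit.
have TE : U + K = T.
  rewrite /K -mulmxA -/T mulmxBl mul1mx -UL -mulmxA LT mulmx1.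
  by rewrite addrC subrK.
have QT : Q *m T = T by rewrite /T !mulmxA QQ.
have BE : B = L *m A *m T by rewrite /B /T !mulmxA.
clearbody T; have QE : Q = T *m (L *m Q).
  apply/eqP; rewrite -subr_eq0; apply/eqP/Q_P0_inj.
    by rewrite mulmxBr QQ (mulmxA Q T) QT.
  by rewrite mulmxBr -UL -!mulmxA (mulmxA L T) LT mul1mx subrr.
split; rewrite ?TE //.
- have -> : K = T - U by rewrite -TE addrC addKr.
  by rewrite mulmxBr LT LU subrr.
- rewrite BE -{1}QT mulmxA -QA {1}QE -!mulmxA; congr (_ *m (_ *m _)).
  by rewrite mulmxA QA -mulmxA QT.
Qed.

End InvariantGraph.

(** * Truncation of unconditionally convergent expansions *)

Section UnconditionalSums.
Variables (R : realType) (I : choiceType) (p q : nat).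
Implicit Types (f : I -> 'M[R[i]]_(p, q)) (s : 'M[R[i]]_(p, q)).

Lemma norm_normc (z : R[i]) : `|z| = (Normc.normc z)%:C.
Proof. by rewrite normc_def; case: z. Qed.

Lemma has_sum_approx f s (e : R) : has_sum f s -> 0 < e ->
  exists J0 : {fset I}, forall J : {fset I}, (J0 `<=` J)%fset ->
    forall i j, Normc.normc (s i j - \sum_(b <- J) f b i j) < e.
Proof.
move=> fs e0; have eC : 0 < e%:C :> R[i] by rewrite ltcR.
have tF : Filter (@totally I) by case: (@totally_filter I).
move/cvg_ballP: fs => /(_ _ eC).
case=> J0 _ J0P; exists J0 => J J0J i j.
case: (J0P J J0J) => _ /(_ i j).
rewrite /ball /= norm_normc ltcR.
have -> : partial_sum f J = \sum_(b <- J) f b by rewrite big_seq_fsetE.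
by rewrite summxE.
Qed.

(** A term outside the finite set that realises the precision 1 is the difference of two
    partial sums that realise it. *)
Lemma has_sum_bounded f s : has_sum f s ->
  exists M : R, forall b i j, Normc.normc (f b i j) <= M.
Proof.
move=> fs; have [J0 J0P] := has_sum_approx fs (@ltr01 R).
exists (2 + \sum_(b <- J0) mnorm (f b)) => b i j.
have S0 : 0 <= \sum_(b <- J0) mnorm (f b).
  by apply: sumr_ge0 => b' _; exact: mnorm_ge0.
have [bJ0|bJ0] := boolP (b \in J0).
  apply: le_trans (normc_le_mnorm _ i j) _.
  rewrite (big_fsetD1 b) //= addrCA lerDl addr_ge0 //.
  by apply: sumr_ge0 => b' _; exact: mnorm_ge0.
have h1 := J0P _ (fsubset_refl J0) i j.
have h2 := J0P _ (fsubsetU1 b J0) i j.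
have -> : f b i j = (s i j - \sum_(b <- J0) f b i j)
   + - (s i j - \sum_(b' <- (b |` J0)%fset) f b' i j).
  by rewrite big_fsetU1 //=; ring.
apply: le_trans (normcD _ _) _; rewrite (@normcN R).
move: h1 h2 S0; lra.
Qed.

Lemma has_sum_remainder f s (L : seq I) (e : R) i j : uniq L -> has_sum f s ->
  (forall J : {fset I}, \sum_(b <- J | b \notin L) Normc.normc (f b i j) <= e) ->
  Normc.normc (s i j - \sum_(b <- L) f b i j) <= e.
Proof.
move=> Lu fs fe; apply/ler_addgt0Pr => e1 e10.
have [J0 J0P] := has_sum_approx fs e10.
pose J := (J0 `|` [fset b in L])%fset.
have h := J0P J (fsubsetUl _ _) i j.
have LJ : \sum_(b <- J | b \in L) f b i j = \sum_(b <- L) f b i j.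
  rewrite -big_filter; apply: perm_big; apply: uniq_perm => //.
    by rewrite filter_uniq // fset_uniq.
  move=> b; rewrite mem_filter andb_idr // => bL.
  by rewrite in_fsetU in_fset bL orbT.
have -> : s i j - \sum_(b <- L) f b i j =
   \sum_(b <- J | b \notin L) f b i j + (s i j - \sum_(b <- J) f b i j).
  by rewrite [\sum_(b <- J) f b i j](bigID (fun b => b \in L)) /= LJ; ring.
apply: le_trans (normcD _ _) _; apply: lerD; last exact: ltW.
apply: le_trans (fe J); rewrite -big_filter -[leRHS]big_filter.
exact: normc_sum.
Qed.

End UnconditionalSums.

Section Multiindices.
Variables (R : realType) (d : nat).
Implicit Types (b : multiindex d) (n m : nat).

(** A multi-index with all entries at most [n] as an element of a finite type, through
    which sums over such multi-indices factor into one-variable sums. *)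
Definition box_index n (g : {ffun 'I_d -> 'I_n.+1}) : multiindex d :=
  [ffun i => val (g i)].

Definition box n : seq (multiindex d) := map (@box_index n) (enum {ffun 'I_d -> 'I_n.+1}).

Definition deg_le n : seq (multiindex d) := [seq b <- box n | (mdegree b <= n)%N].

Lemma le_mdegree b i : (b i <= mdegree b)%N.
Proof. by rewrite /mdegree (bigD1 i) //= leq_addr. Qed.

Lemma box_uniq n : uniq (box n).
Proof.
rewrite map_inj_uniq ?enum_uniq // => g g' /ffunP e.
by apply/ffunP => i; apply: val_inj; have := e i; rewrite !ffunE.
Qed.

Lemma mem_box n b : (mdegree b <= n)%N -> b \in box n.
Proof.
move=> bn; apply/mapP; exists [ffun i => inord (b i)]; first by rewrite mem_enum.
apply/ffunP => i; rewrite !ffunE /= ?ffunE inordK // ltnS.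
exact: leq_trans (le_mdegree b i) bn.
Qed.

Lemma mem_deg_le n b : (b \in deg_le n) = (mdegree b <= n)%N.
Proof. by rewrite mem_filter andb_idr // => /mem_box. Qed.

Lemma deg_le_uniq n : uniq (deg_le n).
Proof. by rewrite filter_uniq // box_uniq. Qed.

(** A finite family lies in a box, over which the sum is a product of [d] geometric
    sums, each less than 2. *)
Lemma sum_half_mdegree (J : {fset multiindex d}) :
  \sum_(b <- J) (2^-1 : R) ^+ mdegree b <= 2 ^+ d.
Proof.
pose n := (\sum_(b <- J) mdegree b)%N.
have Jn b : b \in J -> (mdegree b <= n)%N.
  by move=> bJ; rewrite /n (big_rem b) //= leq_addr.
have half0 k : 0 <= (2^-1 : R) ^+ k by rewrite exprn_ge0 // invr_ge0 ler0n.
have JE : \sum_(b <- J) (2^-1 : R) ^+ mdegree b =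
    \sum_(b <- box n | b \in J) (2^-1 : R) ^+ mdegree b.
  rewrite -[RHS]big_filter; apply: perm_big; apply: uniq_perm.
  - exact: fset_uniq.
  - by rewrite filter_uniq // box_uniq.
  - by move=> b; rewrite mem_filter andb_idr // => /Jn /mem_box.
rewrite JE; apply: (@le_trans _ _ (\sum_(b <- box n) (2^-1 : R) ^+ mdegree b)).
  by rewrite [leRHS](bigID (fun b => b \in J)) /= lerDl sumr_ge0.
rewrite /box big_map big_enum /=.
have -> : \sum_(g : {ffun 'I_d -> 'I_n.+1}) (2^-1 : R) ^+
    mdegree (box_index g) =
  \sum_(g : {ffun 'I_d -> 'I_n.+1}) \prod_i (2^-1 : R) ^+ g i.
  apply: eq_bigr => g _; rewrite /mdegree -prodrXr.
  by apply: eq_bigr => i _; rewrite ffunE.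
rewrite -(bigA_distr_bigA (fun _ (k : 'I_n.+1) => (2^-1 : R) ^+ k)) /=.
rewrite prodr_const card_ord; apply: lerXn2r; rewrite ?nnegrE ?sumr_ge0 ?ler0n //.
suff -> : \sum_(k < n.+1) (2^-1 : R) ^+ k = 2 - 2^-1 ^+ n by rewrite gerBl.
elim: (n) => [|k IH]; first by rewrite big_ord_recr big_ord0 /= !expr0; ring.
by rewrite big_ord_recr /= IH exprS; field.
Qed.

Lemma monomial_le (h : 'rV[R]_d) b (t : R) : (forall i, `|h 0 i| <= t) ->
  `|monomial h b| <= t ^+ mdegree b.
Proof.
move=> ht; rewrite /monomial /mdegree normr_prod -prodrXr.
by apply: ler_prod => i _; rewrite normr_ge0 normrX lerXn2r ?nnegrE // (le_trans _ (ht i)).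
Qed.

End Multiindices.

Section Remainder.
Variables (R : realType) (d p q : nat).

(** Convergence at [h = (rho, ..., rho)] bounds [rho^|b| |c_b|].  For [|h_i| <= t] with
    [t <= rho / 2] the term at [b] is at most a constant times
    [(2 t / rho)^|b| 2^-|b|]: for [|b| > n] the first factor is [O(t^(n+1))], and the
    second one is summable. *)
Lemma expansion_remainder (F : 'rV[R]_d -> 'M[R[i]]_(p, q)) mu0 c n :
  has_expansion F mu0 c ->
  exists M r : R, 0 < r /\ forall (h : 'rV[R]_d) (t : R), 0 <= t -> t <= r ->
    (forall i, `|h 0 i| <= t) -> forall i j,
    Normc.normc (F (mu0 + h) i j -
      \sum_(b <- deg_le d n) (monomial h b)%:C * c b i j) <= M * t ^+ n.+1.
Proof.
move=> /nbhs_ballP[rho0 /= rho00 Fc].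
pose rho := rho0 / 2.
have rho_gt0 : 0 < rho by rewrite divr_gt0.
have Fh (h : 'rV[R]_d) : (forall i, `|h 0 i| <= rho) ->
    has_sum (fun b : multiindex d => (monomial h b)%:C *: c b) (F (mu0 + h)).
  move=> hr; have := Fc (mu0 + h); rewrite [mu0 + h - mu0]addrC addKr; apply.
  split=> // i j; rewrite ord1 /ball /= !mxE opprD addNKr normrN.
  apply: le_lt_trans (hr j) _; rewrite /rho; lra.
have [M0 M0P] : exists M0 : R, forall b i j, rho ^+ mdegree b * Normc.normc (c b i j) <= M0.
  have hrho : forall i, `|(const_mx rho : 'rV[R]_d) 0 i| <= rho.
    by move=> i; rewrite mxE gtr0_norm.
  have [M0 M0P] := has_sum_bounded (Fh _ hrho).
  exists M0 => b i j; have := M0P b i j; rewrite mxE Normc.normcM.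
  have -> : monomial (const_mx rho : 'rV[R]_d) b = rho ^+ mdegree b.
    by rewrite /monomial /mdegree -prodrXr; apply: eq_bigr => k _; rewrite mxE.
  by rewrite normcR ger0_norm // exprn_ge0 // ltW.
have M00 : 0 <= `|M0| by exact: normr_ge0.
exists (`|M0| * (2 / rho) ^+ n.+1 * 2 ^+ d), (rho / 2).
split; first by rewrite divr_gt0.
move=> h t t0 tr ht i j.
have u0 : 0 <= 2 / rho * t by rewrite mulr_ge0 // divr_ge0 ?ltW.
have u1 : 2 / rho * t <= 1.
  by rewrite mulrAC ler_pdivrMr // mul1r mulrC -ler_pdivlMr.
have htr k : `|h 0 k| <= rho.
  apply: le_trans (ht k) (le_trans tr _); rewrite ler_pdivrMr //; lra.
have := has_sum_remainder (deg_le_uniq d n) (Fh h htr)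
  (e := `|M0| * (2 / rho) ^+ n.+1 * 2 ^+ d * t ^+ n.+1) (i := i) (j := j).
rewrite (eq_bigr (fun b => (monomial h b)%:C * c b i j)); last by move=> b _; rewrite mxE.
apply=> J.
have -> : `|M0| * (2 / rho) ^+ n.+1 * 2 ^+ d * t ^+ n.+1 =
    (`|M0| * (2 / rho * t) ^+ n.+1) * 2 ^+ d.
  by rewrite [(2 / rho * t) ^+ _]exprMn mulrA [in RHS]mulrAC.
apply: (@le_trans _ _ (\sum_(b <- J)
    (`|M0| * (2 / rho * t) ^+ n.+1) * 2^-1 ^+ mdegree b)); last first.
  rewrite -mulr_sumr ler_wpM2l ?sum_half_mdegree // mulr_ge0 // exprn_ge0 //.
rewrite [leRHS](bigID (fun b => b \notin deg_le d n)) /=.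
apply: ler_wpDr.
  by apply: sumr_ge0 => b _; rewrite !mulr_ge0 ?exprn_ge0 // invr_ge0.
apply: ler_sum => b; rewrite mem_deg_le -ltnNge => nb.
rewrite mxE Normc.normcM.
rewrite normcR; have c0 := normc_ge0 (c b i j).
apply: (@le_trans _ _ (t ^+ mdegree b * Normc.normc (c b i j))).
  by rewrite ler_wpM2r // monomial_le.
have -> : t ^+ mdegree b * Normc.normc (c b i j) =
   (2 / rho * t) ^+ mdegree b * 2^-1 ^+ mdegree b * (rho ^+ mdegree b * Normc.normc (c b i j)).
  rewrite mulrA -!exprMn; congr (_ ^+ _ * _).
  by field; rewrite lt0r_neq0.
apply: (@le_trans _ _ ((2 / rho * t) ^+ n.+1 * 2^-1 ^+ mdegree b * `|M0|)).
  apply: ler_pM.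
  - by rewrite mulr_ge0 // exprn_ge0 // invr_ge0.
  - by rewrite mulr_ge0 // exprn_ge0 // ltW.
  - by rewrite ler_wpM2r ?exprn_ge0 ?invr_ge0 // ler_wiXn2l.
  - exact: le_trans (M0P b i j) (ler_norm _).
by rewrite le_eqVlt; apply/orP; left; apply/eqP; ring.
Qed.

End Remainder.

(** * Polynomial approximation at the origin *)

Section PolynomialApproximation.
Variable R : realType.
Implicit Types (f g : R -> R[i]) (u v : {poly R[i]}) (D : nat).

Definition approx D f u : Prop := exists M r : R, [/\ 0 <= M, 0 < r & forall t : R,
  0 < t -> t <= r -> Normc.normc (f t - u.[t%:C]) <= M * t ^+ D].

Lemma horner_bounded u : exists B : R, 0 <= B /\
  forall t : R, 0 < t -> t <= 1 -> Normc.normc u.[t%:C] <= B.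
Proof.
elim/poly_ind: u => [|u c [B [B0 BP]]].
  by exists 0; split=> // t _ _; rewrite horner0 Normc.normc0.
exists (B + Normc.normc c); split; first by rewrite addr_ge0 // normc_ge0.
move=> t t0 t1; rewrite hornerMXaddC (le_trans (normcD _ _)) // lerD2r Normc.normcM.
rewrite normcR gtr0_norm // -[leRHS]mulr1.
by apply: ler_pM => //; [exact: normc_ge0|exact: ltW|exact: BP].
Qed.

Lemma approxD D f g u v : approx D f u -> approx D g v ->
  approx D (fun t => f t + g t) (u + v).
Proof.
move=> [M [r [M0 r0 fu]]] [M' [r' [M'0 r'0 gv]]].
exists (M + M'), (Num.min r r'); split; rewrite ?addr_ge0 ?lt_min ?r0 //.
move=> t t0; rewrite le_min => /andP[tr tr'].
rewrite hornerD opprD addrACA (le_trans (normcD _ _)) // mulrDl lerD //.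
  exact: fu.
exact: gv.
Qed.

Lemma approx_poly D u : approx D (fun t => u.[t%:C]) u.
Proof.
exists 0, 1; split=> // t _ _; by rewrite subrr Normc.normc0 mul0r.
Qed.

Lemma approxM D f g u v : approx D f u -> approx D g v ->
  approx D (fun t => f t * g t) (u * v).
Proof.
move=> [M [r [M0 r0 fu]]] [M' [r' [M'0 r'0 gv]]].
have [B [B0 uB]] := horner_bounded u; have [B' [B'0 vB]] := horner_bounded v.
exists ((B + M) * M' + M * B'), (Num.min 1 (Num.min r r')); split.
- by rewrite addr_ge0 // mulr_ge0 // addr_ge0.
- by rewrite !lt_min ltr01 r0.
move=> t t0; rewrite !le_min => /and3P[t1 tr tr'].
have td : 0 <= t ^+ D by rewrite exprn_ge0 // ltW.
have td1 : t ^+ D <= 1 by rewrite exprn_ile1 // ltW.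
have fB : Normc.normc (f t) <= B + M.
  rewrite -[f t](subrK u.[t%:C]) addrC (le_trans (normcD _ _)) // lerD ?uB //.
  by rewrite (le_trans (fu t t0 tr)) // ler_piMr.
rewrite hornerM.
have -> : f t * g t - u.[t%:C] * v.[t%:C] =
  f t * (g t - v.[t%:C]) + (f t - u.[t%:C]) * v.[t%:C] by ring.
rewrite (le_trans (normcD _ _)) // !Normc.normcM mulrDl lerD //.
  by rewrite -mulrA ler_pM ?normc_ge0 ?gv.
by rewrite mulrAC ler_pM ?normc_ge0 ?vB ?fu.
Qed.

Lemma approx_sum (I : Type) (s : seq I) D (f : I -> R -> R[i]) (u : I -> {poly R[i]}) :
  (forall i, approx D (f i) (u i)) ->
  approx D (fun t => \sum_(i <- s) f i t) (\sum_(i <- s) u i).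
Proof.
move=> fu; elim: s => [|i s IH].
  rewrite big_nil; have [M [r [M0 r0 h]]] := approx_poly D (0 : {poly R[i]}).
  by exists M, r; split=> // t t0 tr; rewrite big_nil; have := h t t0 tr; rewrite horner0.
have [M [r [M0 r0 h]]] := approxD (fu i) IH.
by exists M, r; split=> // t t0 tr; rewrite !big_cons; exact: h.
Qed.

Lemma approx_near D f g u (r0 : R) : 0 < r0 -> (forall t, 0 < t -> t <= r0 -> f t = g t) ->
  approx D f u -> approx D g u.
Proof.
move=> r00 fg [M [r [M0 r1 h]]]; exists M, (Num.min r0 r); split; rewrite ?lt_min ?r00 //.
by move=> t t0; rewrite le_min => /andP[tr0 tr]; rewrite -fg // h.
Qed.

(** The constant coefficient is a limit of quantities that tend to 0; the rest of the
    polynomial is divisible by the variable, and one power of [t] can be cancelled. *)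
Lemma approx0_coef D u k : approx D (fun=> 0) u -> (k < D)%N -> u`_k = 0.
Proof.
elim/poly_ind: u D k => [|u c IH] D k; first by rewrite coef0.
case: D => // D [M [r [M0 r0 h]]] kD.
have hE t : 0 < t -> t <= r -> Normc.normc (u.[t%:C] * t%:C + c) <= M * t ^+ D.+1.
  by move=> t0 tr; have := h t t0 tr; rewrite sub0r (@normcN R) hornerMXaddC.
have [B [B0 uB]] := horner_bounded u.
have c0 : c = 0.
  apply: Normc.eq0_normc; apply/le_anti; rewrite normc_ge0 andbT.
  apply/ler_addgt0Pr => e e0; rewrite add0r.
  pose t := Num.min 1 (Num.min r (e / (M + B + 1))).
  have MB : 0 < M + B + 1 by rewrite ltr_wpDl // addr_ge0.
  have t0 : 0 < t by rewrite !lt_min ltr01 r0 divr_gt0.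
  have [t1 tr te] : [/\ t <= 1, t <= r & t <= e / (M + B + 1)].
    by rewrite !ge_min !lexx !orbT.
  have -> : c = (u.[t%:C] * t%:C + c) + - (u.[t%:C] * t%:C) by rewrite addrAC subrr add0r.
  rewrite (le_trans (normcD _ _)) // (@normcN R) Normc.normcM normcR gtr0_norm //.
  apply: (@le_trans _ _ (M * t + B * t)).
    rewrite lerD //; last by rewrite ler_wpM2r ?uB // ltW.
    rewrite (le_trans (hE t t0 tr)) // ler_wpM2l // exprS ler_piMr ?(ltW t0) //.
    by rewrite exprn_ile1 // ltW.
  move: te; rewrite ler_pdivlMr //; move: t0; clear; lra.
have uD : approx D (fun=> 0) u.
  exists M, r; split=> // t t0 tr; rewrite sub0r (@normcN R).
  have ut : Normc.normc u.[t%:C] * t = Normc.normc (u.[t%:C] * t%:C).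
    by rewrite Normc.normcM normcR gtr0_norm.
  rewrite -(ler_pM2r t0) ut.
  by have := hE t t0 tr; rewrite c0 addr0 exprSr mulrA.
rewrite coefD coefMX coefC c0; case: k kD => [|k] kD; first by rewrite addr0.
by rewrite addr0; exact: IH uD _.
Qed.

End PolynomialApproximation.

Section MatrixApproximation.
Variable R : realType.
Implicit Types (p q s D : nat).

Definition mapprox D p q (F : R -> 'M[R[i]]_(p, q)) (P : 'M[{poly R[i]}]_(p, q)) : Prop :=
  forall i j, approx D (fun t => F t i j) (P i j).

Lemma mapproxD D p q (F G : R -> 'M[R[i]]_(p, q)) (P Q : 'M[{poly R[i]}]_(p, q)) :
  mapprox D F P -> mapprox D G Q -> mapprox D (fun t => F t + G t) (P + Q).
Proof.
move=> FP GQ i j; rewrite mxE.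
apply: (approx_near (@ltr01 R) _ (approxD (FP i j) (GQ i j))) => t _ _.
by rewrite mxE.
Qed.

Lemma mapprox_const D p q (M : 'M[R[i]]_(p, q)) :
  mapprox D (fun=> M) (map_mx polyC M).
Proof.
move=> i j; rewrite mxE.
apply: (approx_near (@ltr01 R) _ (approx_poly D (M i j)%:P)) => t _ _.
by rewrite hornerC.
Qed.

Lemma mapproxM D p q s (F : R -> 'M[R[i]]_(p, q)) (G : R -> 'M[R[i]]_(q, s))
    (P : 'M[{poly R[i]}]_(p, q)) (Q : 'M[{poly R[i]}]_(q, s)) :
  mapprox D F P -> mapprox D G Q -> mapprox D (fun t => F t *m G t) (P *m Q).
Proof.
move=> FP GQ i j; rewrite mxE.
have h := approx_sum (index_enum 'I_q) (fun k => approxM (FP i k) (GQ k j)).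
by apply: (approx_near (@ltr01 R) _ h) => t _ _; rewrite mxE.
Qed.

Definition coef_mx (k : nat) p q (P : 'M[{poly R[i]}]_(p, q)) : 'M[R[i]]_(p, q) :=
  map_mx (coefp k) P.

Lemma mapprox_coef D p q (F G : R -> 'M[R[i]]_(p, q)) (P Q : 'M[{poly R[i]}]_(p, q))
    (r0 : R) k :
  0 < r0 -> (forall t, 0 < t -> t <= r0 -> F t = G t) ->
  mapprox D F P -> mapprox D G Q -> (k < D)%N -> coef_mx k P = coef_mx k Q.
Proof.
move=> r00 FG FP GQ kD; apply/matrixP => i j; rewrite !mxE /=.
apply/eqP; rewrite -subr_eq0 -coefB; apply/eqP.
have m1 := approxM (approx_poly D (-1)%:P) (GQ i j).
apply: (@approx0_coef R D _ _ _ kD).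
have -> : P i j - Q i j = P i j + (-1)%:P * Q i j by rewrite polyCN mulN1r.
apply: (approx_near r00 _ (approxD (FP i j) m1)) => t t0 tr.
by rewrite hornerC FG // mulN1r subrr.
Qed.

End MatrixApproximation.

(** * Expansions along a monomial curve *)

Section Weights.
Local Open Scope nat_scope.

(** Uniqueness of the digits in base [q]. *)
Lemma digits_inj d q (f g : 'I_d -> nat) : (forall i, f i < q) -> (forall i, g i < q) ->
  \sum_(i < d) f i * q ^ i = \sum_(i < d) g i * q ^ i -> f =1 g.
Proof.
elim: d f g => [|d IH] f g fq gq; first by move=> _ [].
have shift (h : 'I_d.+1 -> nat) : \sum_(i < d.+1) h i * q ^ i =
    (\sum_(i < d) h (lift ord0 i) * q ^ i) * q + h ord0.
  rewrite big_ord_recl expn0 muln1 addnC big_distrl /=; congr (_ + _).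
  by apply: eq_bigr => i _; rewrite /bump /= add1n expnSr mulnA.
have q0 : 0 < q by exact: leq_ltn_trans (fq ord0).
rewrite !shift => e.
have e0 : f ord0 = g ord0.
  by have := congr1 (modn^~ q) e; rewrite !modnMDl !modn_small.
have es : \sum_(i < d) f (lift ord0 i) * q ^ i = \sum_(i < d) g (lift ord0 i) * q ^ i.
  by apply/eqP; rewrite -(eqn_pmul2r q0) -(eqn_add2r (f ord0)) e e0.
move=> i; case: (unliftP ord0 i) => [j ->|->] //.
exact: (IH (fun j => f (lift ord0 j)) (fun j => g (lift ord0 j))).
Qed.

Variables d n : nat.
Implicit Types a b : multiindex d.

(** Exceeds every value of [digit_code] on degree at most [n], so that there the weight
    orders multi-indices by degree first. *)
Definition base_weight : nat := (n * n.+1 ^ d).+1.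

Definition digit_code b : nat := \sum_(i < d) b i * n.+1 ^ i.

Definition weight b : nat := base_weight * mdegree b + digit_code b.

Lemma digit_code_lt b : mdegree b <= n -> digit_code b < base_weight.
Proof.
move=> bn; rewrite ltnS /digit_code.
apply: (@leq_trans (\sum_(i < d) b i * n.+1 ^ d)).
  by apply: leq_sum => i _; rewrite leq_mul2l leq_pexp2l ?orbT // ltnW.
by rewrite -big_distrl leq_mul2r /= bn orbT.
Qed.

Lemma weight_lt b : mdegree b <= n -> weight b < base_weight * n.+1.
Proof.
move=> bn; rewrite /weight mulnS addnC -addSn leq_add ?digit_code_lt //.
by rewrite leq_mul2l bn orbT.
Qed.

Lemma mdegreeD a b : mdegree (a + b)%R = mdegree a + mdegree b.
Proof. by rewrite /mdegree -big_split; apply: eq_bigr => i _; rewrite ffunE. Qed.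

Lemma weightD a b : weight (a + b)%R = weight a + weight b.
Proof.
rewrite /weight mdegreeD mulnDr addnACA; congr (_ + _).
rewrite /digit_code -big_split; apply: eq_bigr => i _.
by rewrite ffunE mulnDl.
Qed.

(** Only the degree of [a] is bounded: equality of the weights bounds that of [b],
    so a term of degree greater than [n] in a product cannot collide with [a]. *)
Lemma weight_inj a b : mdegree a <= n -> weight b = weight a -> b = a.
Proof.
move=> an e.
have bn : mdegree b <= n.
  rewrite -ltnS -(ltn_pmul2l (ltn0Sn (n * n.+1 ^ d))) -/base_weight.
  by apply: leq_ltn_trans (weight_lt an); rewrite -e leq_addr.
have ce : digit_code b = digit_code a.
  have := congr1 (modn^~ base_weight) e.
  by rewrite /weight ![base_weight * _]mulnC !modnMDl !modn_small ?digit_code_lt.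
apply/ffunP; apply: digits_inj ce => i; rewrite ltnS.
  exact: leq_trans (le_mdegree b i) bn.
exact: leq_trans (le_mdegree a i) an.
Qed.

Lemma weightE b : weight b = \sum_(i < d) (base_weight + n.+1 ^ i) * b i.
Proof.
rewrite /weight /mdegree big_distrr /digit_code -big_split.
by apply: eq_bigr => i _; rewrite mulnDl [b i * _]mulnC.
Qed.

End Weights.

Section CurveExpansion.
Variables (R : realType) (d n : nat) (mu0 : 'rV[R]_d).

Definition curve (t : R) : 'rV[R]_d := \row_i t ^+ (base_weight d n + n.+1 ^ i).

Lemma monomial_curve t (b : multiindex d) : monomial (curve t) b = t ^+ weight n b.
Proof.
rewrite /monomial weightE -prodrXr; apply: eq_bigr => i _.
by rewrite mxE exprM.
Qed.

Lemma curve_le t i : 0 <= t -> t <= 1 -> `|curve t 0 i| <= t ^+ base_weight d n.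
Proof.
move=> t0 t1; rewrite mxE ger0_norm ?exprn_ge0 //.
by rewrite ler_wiXn2l // leq_addr.
Qed.

Lemma near_curve (Q : 'rV[R]_d -> Prop) : (\forall mu \near mu0, Q mu) ->
  exists2 r : R, 0 < r & forall t, 0 < t -> t <= r -> Q (mu0 + curve t).
Proof.
move=> /nbhs_ballP[r /= r0 rQ]; exists (Num.min 1 (r / 2)).
  by rewrite lt_min ltr01 divr_gt0.
move=> t t0; rewrite le_min => /andP[t1 tr]; apply: rQ.
split=> // i j; rewrite ord1 /ball /= !mxE opprD addNKr normrN.
have := curve_le j (ltW t0) t1; rewrite mxE => /le_lt_trans; apply.
apply: (@le_lt_trans _ _ t); last by move: tr; rewrite ler_pdivlMr //; lra.
by rewrite exprS ler_piMr ?exprn_ile1 // ltW.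
Qed.

Definition expansion_poly p q (c : multiindex d -> 'M[R[i]]_(p, q)) :
    'M[{poly R[i]}]_(p, q) :=
  \sum_(b <- deg_le d n) 'X^(weight n b) *: map_mx polyC (c b).

(** On the curve every coordinate is at most [t^base_weight], so the tail of degree
    greater than [n] has the order of the first weight that is not controlled. *)
Lemma mapprox_expansion p q (F : 'rV[R]_d -> 'M[R[i]]_(p, q)) c :
  has_expansion F mu0 c ->
  mapprox (base_weight d n * n.+1) (fun t => F (mu0 + curve t)) (expansion_poly c).
Proof.
move=> Fc i j; have [M [r [r0 h]]] := expansion_remainder n Fc.
exists `|M|, (Num.min 1 r); split; rewrite ?lt_min ?ltr01 // => t t0.
rewrite le_min => /andP[t1 tr].
have -> : (expansion_poly c i j).[t%:C] =
    \sum_(b <- deg_le d n) (monomial (curve t) b)%:C * c b i j.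
  rewrite /expansion_poly summxE horner_sum; apply: eq_bigr => b _.
  by rewrite !mxE hornerM hornerXn hornerC monomial_curve rmorphXn.
have tw0 : 0 <= t ^+ base_weight d n by rewrite exprn_ge0 // ltW.
have twr : t ^+ base_weight d n <= r.
  by apply: le_trans tr; rewrite exprS ler_piMr ?exprn_ile1 // ltW.
apply: le_trans (h _ _ tw0 twr (fun k => curve_le k (ltW t0) t1) i j) _.
by rewrite -exprM ler_wpM2r ?exprn_ge0 ?(ltW t0) // ler_norm.
Qed.

End CurveExpansion.

(** * Coefficients of products *)

Section Coefficients.
Variables (R : realType) (d : nat).
Implicit Types (p q s : nat) (a b : multiindex d).

Lemma coef_mxD k p q (P Q : 'M[{poly R[i]}]_(p, q)) :
  coef_mx k (P + Q) = coef_mx k P + coef_mx k Q.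
Proof. by apply/matrixP => i j; rewrite !mxE /= coefD. Qed.

Lemma coef_mx_sum k p q (I : Type) (r : seq I) (P : I -> 'M[{poly R[i]}]_(p, q)) :
  coef_mx k (\sum_(i <- r) P i) = \sum_(i <- r) coef_mx k (P i).
Proof.
elim: r => [|i r IH]; last by rewrite !big_cons coef_mxD IH.
by rewrite !big_nil; apply/matrixP => i j; rewrite !mxE /= coef0.
Qed.

Lemma coef_mx_monomial k m p q (M : 'M[R[i]]_(p, q)) :
  coef_mx k ('X^m *: map_mx polyC M) = if m == k then M else 0.
Proof.
apply/matrixP => i j; rewrite !mxE /= coefMC coefXn eq_sym.
by case: eqP; rewrite ?mul1r ?mul0r ?mxE.
Qed.

Lemma coef_mx_mulr k p q s (P : 'M[{poly R[i]}]_(p, q)) (M : 'M[R[i]]_(q, s)) :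
  coef_mx k (P *m map_mx polyC M) = coef_mx k P *m M.
Proof.
apply/matrixP => i j; rewrite !mxE /= coef_sum; apply: eq_bigr => l _.
by rewrite !mxE coefMC.
Qed.

Lemma coef_mx_mull k p q s (M : 'M[R[i]]_(p, q)) (P : 'M[{poly R[i]}]_(q, s)) :
  coef_mx k (map_mx polyC M *m P) = M *m coef_mx k P.
Proof.
apply/matrixP => i j; rewrite !mxE /= coef_sum; apply: eq_bigr => l _.
by rewrite !mxE coefCM.
Qed.

Lemma coef_expansion_poly a p q (c : multiindex d -> 'M[R[i]]_(p, q)) n :
  (mdegree a <= n)%N -> coef_mx (weight n a) (expansion_poly n c) = c a.
Proof.
move=> an; rewrite coef_mx_sum (bigD1_seq a) ?deg_le_uniq ?mem_deg_le //=.
rewrite coef_mx_monomial eqxx big1 ?addr0 // => b /eqP ba.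
by rewrite coef_mx_monomial; case: eqP => // /(weight_inj an).
Qed.

Definition convolution p q s (c : multiindex d -> 'M[R[i]]_(p, q))
    (e : multiindex d -> 'M[R[i]]_(q, s)) a : 'M[R[i]]_(p, s) :=
  \sum_(b <- deg_le d (mdegree a)) \sum_(b' <- deg_le d (mdegree a) | b + b' == a)
    c b *m e b'.

(** Weights are additive, so the terms of weight [weight n a] in the product are those
    with [b + b' = a]. *)
Lemma coef_expansion_polyM a p q s (c : multiindex d -> 'M[R[i]]_(p, q))
    (e : multiindex d -> 'M[R[i]]_(q, s)) (n := mdegree a) :
  coef_mx (weight n a) (expansion_poly n c *m expansion_poly n e) = convolution c e a.
Proof.
rewrite mulmx_suml coef_mx_sum; apply: eq_bigr => b _.
rewrite mulmx_sumr coef_mx_sum [RHS]big_mkcond; apply: eq_bigr => b' _.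
rewrite -scalemxAl -scalemxAr scalerA -exprD -map_mxM coef_mx_monomial -weightD.
case: (b + b' =P a) => [->|ne]; first by rewrite eqxx.
by case: eqP => // /(weight_inj (leqnn _)).
Qed.

Lemma mdegree_eq0 a : (mdegree a == 0)%N = (a == 0).
Proof.
apply/eqP/eqP => [a0|->]; last by rewrite /mdegree big1 // => i _; rewrite ffunE.
apply/ffunP => i; rewrite ffunE; apply/eqP.
by rewrite -leqn0 -a0 le_mdegree.
Qed.

Lemma mdegree0 : mdegree (0 : multiindex d) = 0%N.
Proof. by apply/eqP; rewrite mdegree_eq0. Qed.

Lemma deg_le0 : deg_le d 0 = [:: 0].
Proof.
apply: perm_small_eq => //; apply: uniq_perm; rewrite ?deg_le_uniq // => b.
by rewrite mem_deg_le leqn0 mdegree_eq0 inE.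
Qed.

Lemma convolution_split a p q s (c : multiindex d -> 'M[R[i]]_(p, q))
    (e : multiindex d -> 'M[R[i]]_(q, s)) : a != 0 ->
  convolution c e a = c 0 *m e a + c a *m e 0 + inner_convolution c e a.
Proof.
move=> a0; set L := deg_le d (mdegree a).
have Lu : uniq L := deg_le_uniq _ _.
have L0 : 0 \in L by rewrite mem_deg_le mdegree0.
have La : a \in L by rewrite mem_deg_le.
have LP b : (b \in L) = (mdegree b <= mdegree a)%N := mem_deg_le _ b.
rewrite /convolution -/L; clearbody L; rewrite (bigD1_seq 0) //= -(big_filter L (fun b => b != 0)).
rewrite (bigD1_seq a) ?mem_filter ?a0 ?filter_uniq //= big_filter_cond addrA.
congr (_ + _ + _).
- rewrite (big_rem a) //= add0r eqxx big1_seq ?addr0 // => b'.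
  by rewrite add0r rem_filter // mem_filter /= => /andP[/eqP-> ]; rewrite eqxx.
- rewrite (big_rem 0) //= addr0 eqxx big1_seq ?addr0 // => b'.
  rewrite rem_filter // mem_filter /= => /andP[/eqP ab /andP[b0 _]]; move: b0.
  have : mdegree (a + b') = mdegree a by rewrite ab.
  by rewrite mdegreeD -[RHS]addn0 => /addnI/eqP; rewrite mdegree_eq0 => ->.
rewrite /inner_convolution.
pose r := [seq nu <- allpairs pair L L | [&& nu.1 + nu.2 == a, nu.1 != 0 & nu.1 != a]].
have ru : uniq r.
  by rewrite filter_uniq // allpairs_uniq // => -[x1 x2] [y1 y2] _ _ [-> ->].
have -> : [set nu : multiindex d * multiindex d |
    [/\ nu.1 + nu.2 = a, nu.1 <> 0 & nu.1 <> a]] = [set` r].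
  apply/seteqP; split=> -[b b'] /=; rewrite mem_filter /=.
    move=> [ab /eqP b0 /eqP ba]; rewrite ab eqxx b0 ba /=.
    apply/allpairsP; exists (b, b'); rewrite /= !LP -ab mdegreeD.
    by rewrite leq_addr leq_addl.
  by move=> /andP[/and3P[/eqP -> /eqP ? /eqP ?] _].
rewrite -fsbig_seq // /r big_filter [RHS]big_mkcond.
rewrite [RHS]big_allpairs_dep [LHS]big_mkcond /=.
apply: eq_bigr => b _; rewrite -big_mkcond /=.
case: ifP => _; first by apply: eq_bigl => b'; rewrite andbT.
by rewrite big_pred0 // => b'; rewrite andbF.
Qed.

Lemma inner_convolution0 p q s (c : multiindex d -> 'M[R[i]]_(p, q))
    (e : multiindex d -> 'M[R[i]]_(q, s)) : inner_convolution c e 0 = 0.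
Proof.
rewrite /inner_convolution fsbig1 // => -[b b'] /= [bb b0 _].
case: b0; apply/eqP; rewrite -mdegree_eq0 -leqn0.
by rewrite (leq_trans (leq_addr (mdegree b') _)) // -mdegreeD bb mdegree0.
Qed.

End Coefficients.

(** * Continuity at the centre of an expansion, and the recursion *)

Section ExpansionContinuity.
Variables (R : realType) (d p q : nat) (mu0 : 'rV[R]_d).
Variables (F : 'rV[R]_d -> 'M[R[i]]_(p, q)) (c : multiindex d -> 'M[R[i]]_(p, q)).
Hypothesis Fc : has_expansion F mu0 c.

(** The truncation of degree 0. *)
Lemma expansion_linear_bound : exists M r : R, [/\ 0 <= M, 0 < r &
  forall (h : 'rV[R]_d) (t : R), 0 <= t -> t <= r -> (forall i, `|h 0 i| <= t) ->
    mnorm (F (mu0 + h) - c 0) <= M * t].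
Proof.
have [M [r [r0 h]]] := expansion_remainder 0 Fc.
exists (\sum_(i < p) \sum_(j < q) `|M|), r; split => //.
  by apply: sumr_ge0 => i _; apply: sumr_ge0.
move=> x t t0 tr xt; rewrite mulr_suml; apply: ler_sum => i _.
rewrite mulr_suml; apply: ler_sum => j _; rewrite !mxE.
have := h x t t0 tr xt i j; rewrite deg_le0 big_cons big_nil addr0 expr1.
have -> : monomial x 0 = 1.
  by rewrite /monomial big1 // => k _; rewrite ffunE expr0.
rewrite mul1r => /le_trans; apply.
by rewrite ler_wpM2r // ler_norm.
Qed.

Lemma expansion_at_center : F mu0 = c 0.
Proof.
have [M [r [M0 r0 h]]] := expansion_linear_bound.
apply/eqP; rewrite -subr_eq0 -[mu0]addr0; apply/eqP/mnorm_eq0.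
rewrite -[leRHS](mulr0 M); apply: h (ltW r0) _ => // i.
by rewrite mxE normr0.
Qed.

Lemma expansion_continuous (e : R) : 0 < e ->
  \forall mu \near mu0, mnorm (F mu - F mu0) < e.
Proof.
move=> e0; have [M [r [M0 r0 h]]] := expansion_linear_bound.
pose t := Num.min r (e / (M + 1)).
have M1 : 0 < M + 1 by rewrite ltr_wpDl.
have t0 : 0 < t by rewrite lt_min r0 divr_gt0.
apply/nbhs_ballP; exists t => // mu [_ mut]; rewrite expansion_at_center.
have -> : mu = mu0 + (mu - mu0) by rewrite addrC subrK.
apply: (@le_lt_trans _ _ (M * t)).
  apply: h (ltW t0) _ _ => [|i]; first by rewrite ge_min lexx.
  by rewrite ltW // !mxE distrC; exact: mut.
have : t <= e / (M + 1) by rewrite ge_min lexx orbT.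
rewrite ler_pdivlMr //; move: t0; lra.
Qed.

End ExpansionContinuity.

Unset Implicit Arguments.
Set Strict Implicit.
Set Printing Implicit Defensive.

Theorem theorem4p10 (R : realType) (d N m0 : nat)
    (P : set 'rV[R]_d) (mu0 : 'rV[R]_d)
    (A : 'rV[R]_d -> 'M[R[i]]_N) (Ac : multiindex d -> 'M[R[i]]_N)
    (lambda0 : R[i]) (P0 S0 : 'M[R[i]]_N) (Gamma : closed_contour R)
    (U0 : 'M[R[i]]_(N, m0))
    (Kc : multiindex d -> 'M[R[i]]_(N, m0)) (Bc : multiindex d -> 'M[R[i]]_m0)
    (P_open : open P) (P_mu0 : P mu0)
    (A_herm : forall mu, P mu -> A mu \is hermsymmx)
    (A_analytic : real_analytic P A)
    (A_expansion : has_expansion A mu0 Ac)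
    (lambda0_eigen : eigenvalue (A mu0) lambda0)
    (lambda0_mult : mup lambda0 (char_poly (A mu0)) = m0)
    (P0_proj : orthogonal_eigenprojector (A mu0) lambda0 P0)
    (S0_resolvent : reduced_resolvent (A mu0) lambda0 P0 S0)
    (Gamma_encircles : encircles_only Gamma (A mu0) lambda0)
    (U0_isometry : U0 ^t* *m U0 = 1%:M)
    (U0_range : U0 *m U0 ^t* = P0)
    (K_expansion : has_expansion (Kmx Gamma A P0 U0) mu0 Kc)
    (B_expansion : has_expansion (Bmx Gamma A U0) mu0 Bc) :
  let X := inner_convolution Ac Kc in
  let Y := inner_convolution Kc Bc in
  [/\ forall b : multiindex d, Kc b = S0 *m (- (Ac b *m U0) - X b + Y b),
      Bc 0 = lambda0%:M &
      forall b : multiindex d, (1 <= mdegree b)%N ->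
        Bc b = U0 ^t* *m Ac b *m U0 + U0 ^t* *m X b].
Proof.
move=> X Y; set L := U0 ^t*; set K := Kmx Gamma A P0 U0; set B := Bmx Gamma A U0.
have [e e0 riesz_near] := riesz_projector_perturbation (A_herm _ P_mu0)
  Gamma_encircles P0_proj S0_resolvent.
have graph : \forall mu \near mu0, [/\ L *m K mu = 0,
    A mu *m (U0 + K mu) = (U0 + K mu) *m B mu & B mu = L *m (A mu *m (U0 + K mu))].
  have P_near : \forall mu \near mu0, P mu by exact: open_nbhs_nbhs.
  apply: filterS2 P_near (expansion_continuous A_expansion e0) => mu Pmu Amu.
  have [QA QQ inj1 inj2] := riesz_near _ (A_herm mu Pmu) Amu.
  have [g1 g2 g3] := invariant_graph U0_isometry U0_range QA QQ inj1 inj2.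
  by split=> //; rewrite mulmxA.
have [S0P0 P0S0 AS0 S0A] := S0_resolvent.
have LP0 : L *m P0 = L by rewrite -U0_range mulmxA U0_isometry mul1mx.
have P0U0 : P0 *m U0 = U0 by rewrite -U0_range -mulmxA U0_isometry mulmx1.
have S0U0 : S0 *m U0 = 0 by rewrite -P0U0 mulmxA S0P0 mul0mx.
have A0U0 := eigenprojector_range P0_proj P0U0.
(* [P0] commutes with the matrix, here by way of the two equations of [S0]. *)
have P0A0 : P0 *m (A mu0 - lambda0%:M) = 0.
  have A0P0 : (A mu0 - lambda0%:M) *m P0 = 0 by rewrite -U0_range mulmxA A0U0 mul0mx.
  have : P0 *m (A mu0 - lambda0%:M) *m (1%:M - P0) = 0.
    rewrite -S0A mulmxA -[P0 *m _ *m S0]mulmxA AS0 (mulmxBr P0) mulmx1.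
    by case: P0_proj => _ -> _; rewrite subrr mul0mx.
  by rewrite mulmxBr mulmx1 -(mulmxA P0) A0P0 mulmx0 subr0.
have LA0 : L *m A mu0 = lambda0 *: L.
  apply/eqP; rewrite -subr_eq0 -mul_mx_scalar -mulmxBr -{1}LP0 -mulmxA P0A0.
  by rewrite mulmx0.
have [LK0 graph0 B0] := nbhs_singleton graph.
have B_mu0 : B mu0 = lambda0%:M.
  rewrite B0 mulmxA LA0 -scalemxAl mulmxDr U0_isometry LK0 addr0.
  by rewrite scalemx1.
(* At the centre the invariance relation puts [U0 + K] in the eigenspace, whereas [K]
   is orthogonal to it. *)
have K_mu0 : K mu0 = 0.
  have AUK : (A mu0 - lambda0%:M) *m (U0 + K mu0) = 0.
    by rewrite mulmxBl graph0 B_mu0 mul_mx_scalar mul_scalar_mx subrr.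
  have := congr1 (mulmx S0) AUK.
  rewrite mulmx0 mulmxA S0A mulmxDr !mulmxBl !mul1mx P0U0 subrr add0r.
  by rewrite -U0_range -mulmxA LK0 mulmx0 subr0.
have Ac0 : Ac 0 = A mu0 := esym (expansion_at_center A_expansion).
have Kc0 : Kc 0 = 0 by rewrite -(expansion_at_center K_expansion).
have Bc0 : Bc 0 = lambda0%:M by rewrite -(expansion_at_center B_expansion).
have coefs b : [/\ L *m Kc b = 0,
    Ac b *m U0 + convolution Ac Kc b = U0 *m Bc b + convolution Kc Bc b &
    Bc b = L *m (Ac b *m U0 + convolution Ac Kc b)].
  pose n := mdegree b.
  have [r r0 graph_r] := near_curve n graph.
  have mA := mapprox_expansion n A_expansion.
  have mK := mapprox_expansion n K_expansion.
  have mB := mapprox_expansion n B_expansion.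
  have mU := mapprox_const (base_weight d n * n.+1) U0.
  have mL := mapprox_const (base_weight d n * n.+1) L.
  have mUK := mapproxD mU mK; have mAUK := mapproxM mA mUK.
  have wD := weight_lt (leqnn n : (mdegree b <= n)%N).
  have coefAUK : coef_mx (weight n b) (expansion_poly n Ac *m
      (map_mx polyC U0 + expansion_poly n Kc)) =
      Ac b *m U0 + convolution Ac Kc b.
    by rewrite mulmxDr coef_mxD coef_mx_mulr coef_expansion_poly // coef_expansion_polyM.
  split.
  - have := mapprox_coef r0 (fun t t0 tr => let: And3 h _ _ := graph_r t t0 tr in h)
      (mapproxM mL mK) (mapprox_const _ 0) wD.
    rewrite coef_mx_mull coef_expansion_poly // => ->.
    by apply/matrixP => i j; rewrite !mxE /= coefC if_same.
  - have := mapprox_coef r0 (fun t t0 tr => let: And3 _ h _ := graph_r t t0 tr in h)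
      mAUK (mapproxM mUK mB) wD.
    rewrite coefAUK => ->.
    by rewrite mulmxDl coef_mxD coef_mx_mull coef_expansion_poly // coef_expansion_polyM.
  - have := mapprox_coef r0 (fun t t0 tr => let: And3 _ _ h := graph_r t t0 tr in h)
      mB (mapproxM mL mAUK) wD.
    by rewrite coef_expansion_poly // coef_mx_mull coefAUK.
split=> // [b|b b1].
- have [b0|b0] := eqVneq b 0.
    rewrite b0 /X /Y !inner_convolution0 Kc0 Ac0 subr0 addr0 mulmxN.
    move: A0U0; rewrite mulmxBl => /subr0_eq ->.
    by rewrite mul_scalar_mx -scalemxAr S0U0 scaler0 oppr0.
  have [LKb eqb _] := coefs b; move: eqb.
  rewrite !convolution_split // Kc0 Bc0 mulmx0 mul0mx addr0 add0r -/(X b) -/(Y b).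
  move=> /(congr1 (mulmx S0)); rewrite !mulmxDr !(mulmxA S0) S0U0 mul0mx add0r.
  have -> : S0 *m Ac 0 *m Kc b = Kc b + S0 *m Kc b *m lambda0%:M.
    apply/eqP; rewrite -subr_eq Ac0 mul_mx_scalar scalemxAl -mul_mx_scalar.
    rewrite -mulmxBl -mulmxBr S0A mulmxBl mul1mx -U0_range -mulmxA LKb mulmx0.
    by rewrite subr0.
  rewrite !mulmxN !mulmxA => eqb.
  apply: (addrI (S0 *m Kc b *m lambda0%:M)).
  by rewrite [RHS]addrCA -eqb addrACA addNr add0r [RHS]addrC addrK addrC.
- have b0 : b != 0 by rewrite -mdegree_eq0 -lt0n.
  have [LKb _ ->] := coefs b.
  rewrite convolution_split // Kc0 mulmx0 addr0 !mulmxDr Ac0 !mulmxA LA0.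
  by rewrite -scalemxAl LKb scaler0 add0r.
Qed.
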